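(* Let $\mathbb{F}$ be a field with $\mathrm{char}(\mathbb{F})\notin\{2,3\}$, and let $C_3\rtimes Dih_8$ be the semidirect product of the cyclic group $C_3$ of order $3$ with the dihedral group $Dih_8$ of order $8$, where the kernel of the conjugation action of $Dih_8$ on $C_3$ is isomorphic to $C_2\times C_2$. Then $\beta(C_3\rtimes Dih_8)=9$.
   Context: The group in question has order $24$ and is GAP's SmallGroup(24,8). For a finite group $G$, a $G$-module is a finite dimensional $\mathbb{F}$-vector space $V$ with a linear action of $G$. $S(V)$ is the symmetric algebra of $V$ (a polynomial algebra on a basis of $V$, with each variable of degree one), on which $G$ acts by $\mathbb{F}$-algebra automorphisms extending the action on $V$, and $S(V)^G$ is the subalgebra of $G$-invariants. $\beta(S(V)^G)$ is the minimal non-negative integer $d$ such that the $\mathbb{F}$-algebra $S(V)^G$ is generated by its homogeneous components of degree at most $d$. The Noether number is $\beta(G)=\sup\{\beta(S(V)^G): V \text{ is a } G\text{-module over }\mathbb{F}\}$. *)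

(* Defs.v *)
From mathcomp Require Import all_boot all_order all_algebra all_fingroup all_solvable all_character.
From mathcomp.multinomials Require Import mpoly.

Set Implicit Arguments.
Unset Strict Implicit.
Unset Printing Implicit Defensive.

Import GRing.Theory.
Local Open Scope ring_scope.

Definition is_minimum (P : nat -> Prop) (d : nat) : Prop :=
  P d /\ forall e, P e -> (d <= e)%N.

Inductive alg_gen (R : comNzRingType) (n : nat) (A : {mpoly R[n]} -> Prop) :
    {mpoly R[n]} -> Prop :=
  | alg_gen_in p : A p -> alg_gen A p
  | alg_gen_const c : alg_gen A c%:MP
  | alg_gen_add p q : alg_gen A p -> alg_gen A q -> alg_gen A (p + q)
  | alg_gen_mul p q : alg_gen A p -> alg_gen A q -> alg_gen A (p * q).

Section NoetherNumber.

Variables (F : fieldType) (gT : finGroupType) (G : {group gT}).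

Section Module.

(* V is the space of row vectors of length n, on which G acts by v |-> v *m rG g;
   S(V) is {mpoly F[n]}, the variable 'X_i being the i-th standard basis vector.
   This is a right action; taking inverses makes it a left action with the same
   invariants. *)
Variables (n : nat) (rG : mx_representation F G n).

Definition sym_act (g : gT) (p : {mpoly F[n]}) : {mpoly F[n]} :=
  comp_mpoly [tuple \sum_(j < n) rG g i j *: 'X_j | i < n] p.

Definition invariant (p : {mpoly F[n]}) : Prop :=
  forall g, g \in G -> sym_act g p = p.

Definition invariants_gen_le (d : nat) : Prop :=
  forall p, invariant p ->
    alg_gen (fun q => invariant q /\ exists2 e, (e <= d)%N & q \is e.-homog) p.

Definition is_beta (d : nat) : Prop := is_minimum invariants_gen_le d.

End Module.

(* The supremum is taken in the naturals with infinity: a module for which no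
   degree bound existed would have beta infinite and admit no upper bound d. *)
Definition beta_upper_bound (d : nat) : Prop :=
  forall (n : nat) (rG : mx_representation F G n),
    exists2 b, is_beta rG b & (b <= d)%N.

Definition is_noether_number (d : nat) : Prop := is_minimum beta_upper_bound d.

End NoetherNumber.

Arguments is_noether_number F {gT} G d.

(* Main.v *)
From HB Require Import structures.
Require Import Defs.
From mathcomp Require Import all_boot all_order all_algebra all_fingroup all_solvable all_character.
From mathcomp.multinomials Require Import mpoly.
From mathcomp Require Import ring zify.
From Stdlib Require Import Classical_Prop.

(** The subgroup A generated by c (of order 3) and the involutions z, b is
    abelian of index 2, and an involution t outside A acts on it by
    c -> c^-1, z -> z, b -> z b. Once a primitive cube root of unity [om] is
    adjoined, A is diagonalizable: every polynomial is a sum of products of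
    linear forms that are weight vectors for A, the weights being the elements
    (i, s, e) of Z/3 x Z/2 x Z/2, and t permutes weight vectors, flipping
    (i, s, e) to (-i, s, e + s). Hence the invariants are spanned by the sums
    tau(m) = m + t m over the products m of weight vectors of total weight 0.

    Upper bound. If m = x y z w where the factors have weights a, -a, -a, a
    and a is trivial on z (so that flipping negates a), then
      2 tau(m) = tau(xy) tau(zw) + tau(xz) tau(yw) - tau(x tw) tau(y tz),
    and all six arguments on the right are products of weight vectors of total
    weight 0 ([transfer]). So tau(m) is decomposable as soon as at most one of
    the four factors is empty. Such a factorization exists for every product
    of ten or more weight vectors of total weight 0 ([four_blocks]); this comes
    from a finite statement on multisets of nine weights, checked by an
    exhaustive search ([search_all]). Invariants over F are then recovered from
    those over F[om] by taking coordinates ([descent]).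

    Lower bound. Let w have weight (0, 0, 1) and t w = - w, and let u and v = t u
    have weights (1, 1, 0) and (-1, 1, 1). An A-invariant monomial
    w^a u^i v^j has i = j mod 6 and a = j mod 2, so one of odd degree in w and
    total degree at most 8 has i = j and is negated by t: invariants of degree
    at most 8 are even in w ([low_degree_w_even]), and so is everything they
    generate. But w u v (u^6 - v^6) is an invariant that is odd in w. A module
    over F with these weights, and an invariant over F going to a multiple of
    w u v (u^6 - v^6), are written down explicitly ([witness]); the module is
    transported to the given group by writing its elements uniquely as
    c^i z^j b^k t^l ([representation_of_matrices]). *)

Set Implicit Arguments.
Unset Strict Implicit.
Unset Printing Implicit Defensive.

Import GRing.Theory.

(** * Weights and their zero-sum sequences *)

(** A character of A, by the exponents of its values on c, z and b. The
    residues 0, 1, -1 modulo 3 are [None], [Some true] and [Some false]. *)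
Definition weight := (option bool * bool * bool)%type.

Definition add3 (a b : option bool) : option bool :=
  match a, b with
  | None, _ => b
  | _, None => a
  | Some true, Some true => Some false
  | Some false, Some false => Some true
  | _, _ => None
  end.

Definition addw (v w : weight) : weight :=
  let: (a, s, e) := v in let: (a', s', e') := w in
  (add3 a a', s (+) s', e (+) e').
Definition oppw (v : weight) : weight :=
  let: (a, s, e) := v in (omap negb a, s, e).
Definition w0 : weight := (None, false, false).

(** The action of t on characters: conjugation by t inverts c, fixes z and
    sends b to z b. *)
Definition flipw (v : weight) : weight :=
  let: (a, s, e) := v in (omap negb a, s, e (+) s).

Arguments addw : simpl never.
Arguments oppw : simpl never.
Arguments flipw : simpl never.

Lemma addwA : associative addw.
Proof. by case=> [[[[]|] []] []] [[[[]|] []] []] [[[[]|] []] []]. Qed.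
Lemma addwC : commutative addw.
Proof. by case=> [[[[]|] []] []] [[[[]|] []] []]. Qed.
Lemma add0w : left_id w0 addw.
Proof. by case=> [[[[]|] []] []]. Qed.
Lemma addw0 : right_id w0 addw.
Proof. by case=> [[[[]|] []] []]. Qed.
Lemma addwN v : addw v (oppw v) = w0.
Proof. by case: v => [[[[]|] []] []]. Qed.
Lemma addNw v : addw (oppw v) v = w0.
Proof. by rewrite addwC addwN. Qed.
Lemma oppwK : involutive oppw.
Proof. by case=> [[[[]|] []] []]. Qed.
Lemma oppw_even v : (oppw v).1.2 = v.1.2.
Proof. by case: v => [[]]. Qed.
Lemma flipwD v w : flipw (addw v w) = addw (flipw v) (flipw w).
Proof. by case: v w => [[[[]|] []] []] [[[[]|] []] []]. Qed.
(** For such weights a block of weight a can be paired both with a block of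
    weight -a and with the flip of another block of weight a. *)
Lemma flipw_even v : ~~ v.1.2 -> flipw v = oppw v.
Proof. by case: v => [[[[]|] []] []]. Qed.

Definition sumw : seq weight -> weight := foldr addw w0.

Lemma sumw_cat l m : sumw (l ++ m) = addw (sumw l) (sumw m).
Proof. by elim: l => [|v l IHl] /=; [rewrite add0w | rewrite IHl addwA]. Qed.
Lemma perm_sumw l m : perm_eq l m -> sumw l = sumw m.
Proof.
move: l m; apply: catCA_perm_subst => l m n.
by rewrite !sumw_cat !addwA (addwC (sumw l)).
Qed.
Lemma sumw_flip l : sumw (map flipw l) = flipw (sumw l).
Proof. by elim: l => //= v l ->; rewrite flipwD. Qed.

(** An equality test that the kernel evaluates quickly: the generic one goes
    through several layers of structures at each comparison. *)
Definition eqw (v w : weight) : bool :=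
  let: (a, s, e) := v in let: (a', s', e') := w in
  match a, a' with
  | None, None => true
  | Some x, Some y => ~~ (x (+) y)
  | _, _ => false
  end && ~~ (s (+) s') && ~~ (e (+) e').

Lemma eqwP v w : reflect (v = w) (eqw v w).
Proof. by apply: (iffP idP); move: v w => [[[[]|] []] []] [[[[]|] []] []]. Qed.

(** Tries every way of adding to a block of sum [s] some elements of [l], and
    runs [k] on the sum of the block and on what is left. *)
Fixpoint extend (s : weight) (l rest : seq weight)
    (k : weight -> seq weight -> bool) : bool :=
  if l is g :: l' then
    extend s l' (g :: rest) k || extend (addw s g) l' rest k
  else k s rest.

Fixpoint pick_block (l rest : seq weight)
    (k : weight -> seq weight -> bool) : bool :=
  if l is g :: l' then pick_block l' (g :: rest) k || extend g l' rest k
  else false.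

Lemma perm_move (g : weight) l rest : perm_eq (g :: l ++ rest) (l ++ g :: rest).
Proof. by rewrite -(cat1s g (l ++ rest)) -(cat1s g rest) perm_catCA. Qed.

Lemma extendP s l rest k : extend s l rest k ->
  exists b r, perm_eq (l ++ rest) (b ++ r) /\ k (addw s (sumw b)) r.
Proof.
elim: l s rest => [|g l IHl] s rest /=.
  by exists [::], rest; rewrite /= addw0.
case/orP => /IHl [b [r [p kb]]].
  by exists b, r; split=> //; apply: perm_trans p; apply: perm_move.
by exists (g :: b), r; rewrite /= perm_cons addwA.
Qed.

Lemma pick_blockP l rest k : pick_block l rest k ->
  exists b r, [/\ perm_eq (l ++ rest) (b ++ r), b != [::] & k (sumw b) r].
Proof.
elim: l rest => [//|g l IHl] rest /=.
case/orP=> [/IHl [b [r [p nb kb]]] | /extendP [b [r [p kb]]]].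
  by exists b, r; split=> //; apply: perm_trans p; apply: perm_move.
by exists (g :: b), r; rewrite /= perm_cons.
Qed.

(** What the search looks for in a prefix of a zero-sum sequence. If
    [a = w0], then [x], [y] and the rest of the sequence have weight 0; otherwise
    [x], [y], [z] have weights a, -a, -a and the rest of the sequence has weight
    a. [x], [y] and, in the second case, [z] are nonempty. *)
Definition breakable (l : seq weight) : Prop :=
  exists a x y z w,
    [/\ perm_eq l (x ++ y ++ z ++ w), ~~ a.1.2, x != [::] /\ y != [::],
        sumw x = a /\ sumw y = oppw a
      & a = w0 \/ z != [::] /\ sumw z = oppw a].

Lemma breakable_cat l m l' : perm_eq l' (l ++ m) -> breakable l -> breakable l'.
Proof.
move=> pl [a [x [y [z [w [p ev ne sxy alt]]]]]].
exists a, x, y, z, (w ++ m); split=> //.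
by rewrite (perm_trans pl) // !catA perm_cat2r -!catA.
Qed.

(** The search calls this when [acc] itself has been tested, so [g] may be
    put in the first block. When the second block has weight a like the first one,
    the third, of weight -a, plays the role of [x] with a replaced by -a. *)
Definition breaks (g : weight) (acc : seq weight) : bool :=
  extend g acc [::] (fun a r => ~~ a.1.2 && pick_block r [::] (fun b r' =>
    eqw a w0 && eqw b w0 ||
    (eqw b (oppw a) || eqw b a) &&
      pick_block r' [::] (fun c _ => eqw c (oppw a)))).

Lemma breaksP g acc : breaks g acc -> breakable (g :: acc).
Proof.
case/extendP=> x [r [px /andP[ev]]] /pick_blockP [y [r' [py ny]]].
rewrite !cats0 in px py.
have p : perm_eq (g :: acc) ((g :: x) ++ y ++ r').
  by rewrite /= perm_cons (perm_trans px) // perm_cat2l.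
case/orP=> [/andP[/eqwP a0 /eqwP b0] | /andP[/orP eb]].
  by exists w0, (g :: x), y, r', [::]; rewrite cats0; split=> //; left.
case/pick_blockP=> z [w [pz nz /eqwP sz]]; rewrite cats0 in pz.
have {p pz}p : perm_eq (g :: acc) ((g :: x) ++ y ++ z ++ w).
  by rewrite (perm_trans p) // !perm_cat2l.
case: eb => /eqwP sy.
  by exists (sumw (g :: x)), (g :: x), y, z, w; split=> //; right.
exists (oppw (sumw (g :: x))), z, (g :: x), y, w; rewrite oppwK; split=> //.
- by rewrite (perm_trans p) // perm_sym (perm_catCA z) perm_cat2l perm_catCA.
- by rewrite oppw_even.
- by right; rewrite sy.
Qed.

(** Are all multisets made of [acc] and [k] elements of [ws] breakable? Each
    multiset is reached once, by choosing the multiplicity of the head of [ws], and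
    a branch is cut as soon as its prefix is breakable. *)
Fixpoint search (ws : seq weight) (k : nat) (acc : seq weight) {struct ws} :=
  if ws is g :: ws' then
    (fix repeat k acc {struct k} :=
      search ws' k acc &&
        (if k is k'.+1 then breaks g acc || repeat k' (g :: acc) else true))
      k acc
  else k != 0.

Lemma searchP ws k acc l :
  search ws k acc -> size l = k -> {subset l <= ws} -> breakable (l ++ acc).
Proof.
elim: ws k acc l => [|g ws IHws] k acc l /=.
  by case: l => [|h l] k0 sl; [rewrite -sl in k0 | move/(_ h (mem_head h l))].
elim: k acc l => [|k IHk] acc l /=.
  by case: l => // + _ _; rewrite andbT => /IHws; apply.
case/andP=> no_g with_g sl lws; have [gl | ngl] := boolP (g \in l); last first.
  apply: IHws no_g sl _ => h hl; have:= lws h hl.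
  by rewrite inE => /orP[/eqP hg|//]; rewrite -hg hl in ngl.
have pl : perm_eq (l ++ acc) (rem g l ++ g :: acc).
  by rewrite (perm_trans _ (perm_move _ _ _)) // -cat_cons perm_cat2r perm_to_rem.
case/orP: with_g => [/breaksP | /IHk IH].
  apply: (@breakable_cat _ (rem g l)); rewrite (perm_trans pl) //.
  by rewrite perm_catC.
apply: (@breakable_cat (rem g l ++ g :: acc) [::]); first by rewrite cats0.
apply: IH; first by rewrite size_rem // sl.
by move=> h /mem_rem /lws.
Qed.

Definition all_weights : seq weight :=
  [seq (a, b.1, b.2) | a <- [:: None; Some true; Some false],
     b <- [:: (false, false); (false, true); (true, false); (true, true)]].

Lemma mem_all_weights v : v \in all_weights.
Proof. by case: v => [[[[]|] []] []]. Qed.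

Lemma search_all : search all_weights 9 [::].
Proof.
(* Evaluated by the lazy conversion of the kernel, where && and || stop at their
   first argument; a call-by-value evaluation would explore every branch. *)
exact_no_check (erefl true).
Qed.

Lemma breakable9 l : size l = 9 -> breakable l.
Proof.
move=> sl; rewrite -[l]cats0.
by apply: (searchP search_all sl) => v _; apply: mem_all_weights.
Qed.

(** Blocks are found among the weights; this finds them among the objects
    that carry the weights. *)
Lemma perm_map_lift (T U : eqType) (f : T -> U) (l : seq T) (m : seq U) :
  perm_eq (map f l) m -> exists2 l', perm_eq l l' & map f l' = m.
Proof.
elim: m l => [|u m IHm] l.
  by move/perm_nilP => /(congr1 size); rewrite size_map => /size0nil ->; exists [::].
move=> p; have: u \in map f l by rewrite (perm_mem p) mem_head.
case/mapP=> t tl ut; have pt := perm_to_rem tl.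
have: perm_eq (map f (rem t l)) m.
  rewrite -(perm_cons u) -(permPr p) {1}ut -[_ :: _]/(map f (t :: _)) perm_sym.
  exact: perm_map.
case/IHm=> l' pl' ml'; exists (t :: l'); last by rewrite /= ml' ut.
by rewrite (perm_trans pt) // perm_cons.
Qed.

Lemma map_eq_cat (T U : Type) (f : T -> U) l u v : map f l = u ++ v ->
  exists l1 l2, [/\ l = l1 ++ l2, map f l1 = u & map f l2 = v].
Proof.
move=> E; exists (take (size u) l), (drop (size u) l).
by rewrite cat_take_drop map_take map_drop E take_size_cat // drop_size_cat.
Qed.

(** The tenth element is outside the blocks found among the first nine, so
    that what is left is a nonempty [z] when [breakable] provides only [x] and [y].
    In all cases the last block gets its weight from the total. *)
Lemma four_blocks (T : eqType) (wt : T -> weight) (l : seq T) :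
    9 < size l -> sumw (map wt l) = w0 ->
  exists a x y z w, [/\ perm_eq l (x ++ y ++ z ++ w), ~~ a.1.2,
    [/\ x != [::], y != [::] & z != [::]],
    sumw (map wt x) = a /\ sumw (map wt y) = oppw a
    & sumw (map wt z) = oppw a /\ sumw (map wt w) = a].
Proof.
move=> sl l0; have s9 : size (map wt (take 9 l)) = 9.
  by rewrite size_map size_takel // ltnW.
have nd : drop 9 l != [::] by rewrite -size_eq0 size_drop subn_eq0 -ltnNge.
have [a [x' [y' [z' [w' [p ev [nx ny] [sx sy] alt]]]]]] := breakable9 s9.
have [t pt] := perm_map_lift p.
case/map_eq_cat=> x [t1 [Et Ex]] /map_eq_cat [y [t2 [Et1 Ey]]].
case/map_eq_cat=> z [w [Et2 Ez Ew]].
have pl : perm_eq l (x ++ y ++ z ++ w ++ drop 9 l).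
  rewrite -{1}[l](cat_take_drop 9) !catA perm_cat2r (perm_trans pt) //.
  by rewrite Et Et1 Et2 !catA.
have nmap m m' : map wt m = m' -> m' != [::] -> m != [::] by move=> <-; case: m.
move: l0; rewrite (perm_sumw (perm_map wt pl)) !map_cat !sumw_cat Ex Ey sx sy.
rewrite addwA addwN add0w => l0.
case: alt => [a0 | [nz sz]].
  exists a, x, y, (z ++ w ++ drop 9 l), [::]; rewrite cats0 Ex Ey; split=> //.
  - split; [exact: nmap nx | exact: nmap ny | by case: (z) (w) (drop 9 l) nd => [|?] // [|?] //].
  - by rewrite !map_cat !sumw_cat l0 a0.
exists a, x, y, z, (w ++ drop 9 l); rewrite Ex Ey Ez; split=> //.
  by split; [exact: nmap nx | exact: nmap ny | exact: nmap nz].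
split=> //; rewrite map_cat sumw_cat; move: l0; rewrite Ez sz.
move/(congr1 (addw a)); rewrite addwA addwN add0w addw0; exact.
Qed.

(** Products of weight vectors, abstractly: [ok w u] stands for u being a
    linear form of weight w, [T] for the action of t and [Alg] for the
    subalgebra that is to contain all invariants. *)
Section Transfer.

Variables (S : comNzRingType) (T : S -> S) (Alg : S -> Prop).
Variable (ok : weight -> S -> Prop).
Hypotheses (TM : {morph T : u v / (u * v)%R}) (TK : involutive T).
Hypothesis T1 : T 1%R = 1%R.
Hypothesis ok_flip : forall w u, ok w u -> ok (flipw w) (T u).
Hypotheses (AlgD : forall u v, Alg u -> Alg v -> Alg (u + v)%R)
  (AlgN : forall u, Alg u -> Alg (- u)%R)
  (AlgM : forall u v, Alg u -> Alg v -> Alg (u * v)%R)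
  (Alg_half : forall u, Alg (u + u)%R -> Alg u).

Local Open Scope ring_scope.

Definition item := (weight * S)%type.
Definition good (l : seq item) := forall p, p \in l -> ok p.1 p.2.
Definition monom (l : seq item) : S := \prod_(p <- l) p.2.
Definition flip (l : seq item) : seq item := [seq (flipw p.1, T p.2) | p <- l].

Hypothesis base : forall l, good l -> sumw (map fst l) = w0 -> (size l <= 9)%N ->
  Alg (monom l + T (monom l)).

Lemma monom_cat l m : monom (l ++ m) = monom l * monom m.
Proof. exact: big_cat. Qed.

Lemma monom_flip l : monom (flip l) = T (monom l).
Proof. by rewrite /monom big_map (big_morph T TM T1). Qed.

Lemma sumw_fst_flip l : sumw (map fst (flip l)) = flipw (sumw (map fst l)).
Proof. by rewrite -sumw_flip -!map_comp. Qed.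

Lemma good_cat l m : good (l ++ m) <-> good l /\ good m.
Proof.
split=> [g | [gl gm] p]; last by rewrite mem_cat => /orP[/gl|/gm].
by split=> p pl; apply: g; rewrite mem_cat pl ?orbT.
Qed.

Lemma good_flip l : good l -> good (flip l).
Proof. by move=> gl _ /mapP[p pl ->]; apply/ok_flip/gl. Qed.

(** The sum of [monom l] and its flip is decomposable when [l] is long: with
    the four blocks of [four_blocks], twice this sum is a combination of products of
    six such sums for shorter sequences. *)
Lemma transfer l : good l -> sumw (map fst l) = w0 -> Alg (monom l + T (monom l)).
Proof.
have [n] := ubnP (size l); elim: n l => [//|n IHn] l ln gl l0.
have [/base|l9] := leqP (size l) 9; first exact.
have [a [x [y [z [w [p ev [nx ny nz] [sx sy] [sz sw]]]]]]] := four_blocks l9 l0.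
have : good (x ++ y ++ z ++ w) by move=> q; rewrite -(perm_mem p); apply: gl.
case/good_cat=> gx /good_cat [gy] /good_cat [gz gw].
have sl : (size x + size y + size z + size w <= n)%N.
  by rewrite -!addnA -!size_cat -(perm_size p).
rewrite -!size_eq0 -!lt0n in nx ny nz.
have short u v : good u -> good v -> addw (sumw (map fst u)) (sumw (map fst v)) = w0 ->
    (size u + size v < n)%N ->
    Alg (monom u * monom v + T (monom u) * T (monom v)).
  move=> gu gv s0 s; rewrite -TM -monom_cat; apply: IHn.
  - by rewrite size_cat.
  - exact/good_cat.
  - by rewrite map_cat sumw_cat.
have Axy := short _ _ gx gy; have Azw := short _ _ gz gw.
have Axz := short _ _ gx gz; have Ayw := short _ _ gy gw.
(* a flipped block of weight a, resp. -a, has weight -a, resp. a *)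
have Axw := short _ _ gx (good_flip gw).
have Ayz := short _ _ gy (good_flip gz).
move: Axy Azw Axz Ayw Axw Ayz.
rewrite !monom_flip !sumw_fst_flip !TK sx sy sz sw addwN addNw.
rewrite !flipw_even; [|by rewrite oppw_even|done]; rewrite oppwK addwN addNw.
rewrite /flip !size_map.
move=> /(_ erefl) Axy /(_ erefl) Azw /(_ erefl) Axz /(_ erefl) Ayw /(_ erefl) Axw /(_ erefl) Ayz.
have bounds a1 a2 a3 a4 : (a1 + a2 + a3 + a4 <= n)%N ->
    (0 < a1)%N -> (0 < a2)%N -> (0 < a3)%N ->
    [/\ (a1 + a2 < n)%N, (a3 + a4 < n)%N & (a1 + a3 < n)%N] /\
    [/\ (a2 + a4 < n)%N, (a1 + a4 < n)%N & (a2 + a3 < n)%N].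
  by move=> *; split; split; lia.
have [[bxy bzw bxz] [byw bxw byz]] := bounds _ _ _ _ sl nx ny nz.
have {Axy Azw}A1 := AlgM (Axy bxy) (Azw bzw).
have {Axz Ayw}A2 := AlgM (Axz bxz) (Ayw byw).
have {Axw Ayz}A3 := AlgM (Axw bxw) (Ayz byz).
apply: Alg_half; have := AlgD (AlgD A1 A2) (AlgN A3); congr Alg.
have -> : monom l = monom x * (monom y * (monom z * monom w)).
  by rewrite -!monom_cat; apply: perm_big.
by rewrite !TM; ring.
Qed.

End Transfer.

Local Open Scope ring_scope.

(** * Adjoining a cube root of unity *)

Section Eisenstein.

Variable F : fieldType.

(** F[om] with om^2 + om + 1 = 0, in coordinates with respect to 1 and om. It
    is a field only if F has no primitive cube root of unity; working over this
    ring in all cases avoids the distinction. *)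
Record eis := Eis { re_eis : F; im_eis : F }.

Definition pair_of_eis (x : eis) := (re_eis x, im_eis x).
Definition eis_of_pair (x : F * F) := Eis x.1 x.2.
Lemma pair_of_eisK : cancel pair_of_eis eis_of_pair.
Proof. by case. Qed.
HB.instance Definition _ := Choice.copy eis (can_type pair_of_eisK).

Lemma eis_eqP (x y : eis) : re_eis x = re_eis y -> im_eis x = im_eis y -> x = y.
Proof. by case: x y => [? ?] [? ?] /= -> ->. Qed.

Definition eis_add (x y : eis) :=
  Eis (re_eis x + re_eis y) (im_eis x + im_eis y).
Definition eis_opp (x : eis) := Eis (- re_eis x) (- im_eis x).
Definition eis_mul (x y : eis) :=
  Eis (re_eis x * re_eis y - im_eis x * im_eis y)
    (re_eis x * im_eis y + im_eis x * re_eis y - im_eis x * im_eis y).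

Lemma eis_addA : associative eis_add.
Proof. by move=> x y z; apply: eis_eqP => /=; ring. Qed.
Lemma eis_addC : commutative eis_add.
Proof. by move=> x y; apply: eis_eqP => /=; ring. Qed.
Lemma eis_add0 : left_id (Eis 0 0) eis_add.
Proof. by move=> x; apply: eis_eqP => /=; ring. Qed.
Lemma eis_addN : left_inverse (Eis 0 0) eis_opp eis_add.
Proof. by move=> x; apply: eis_eqP => /=; ring. Qed.

HB.instance Definition _ := GRing.isZmodule.Build eis
  eis_addA eis_addC eis_add0 eis_addN.

Lemma eis_mulA : associative eis_mul.
Proof. by move=> x y z; apply: eis_eqP => /=; ring. Qed.
Lemma eis_mulC : commutative eis_mul.
Proof. by move=> x y; apply: eis_eqP => /=; ring. Qed.
Lemma eis_mul1 : left_id (Eis 1 0) eis_mul.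
Proof. by move=> x; apply: eis_eqP => /=; ring. Qed.
Lemma eis_mulD : left_distributive eis_mul +%R.
Proof. by move=> x y z; apply: eis_eqP => /=; ring. Qed.
Lemma eis_1neq0 : (Eis 1 0) != 0.
Proof. by apply/eqP => -[] /eqP; rewrite oner_eq0. Qed.

HB.instance Definition _ := GRing.Zmodule_isComNzRing.Build eis
  eis_mulA eis_mulC eis_mul1 eis_mulD eis_1neq0.

Definition om := Eis 0 1.

Lemma om_sum : 1 + om + om ^+ 2 = 0.
Proof. by rewrite expr2; apply: eis_eqP => /=; ring. Qed.

Definition emb (a : F) := Eis a 0.

Lemma emb_is_additive : zmod_morphism emb.
Proof. by move=> a b; apply: eis_eqP => //=; rewrite subr0. Qed.
Lemma emb_is_multiplicative : monoid_morphism emb.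
Proof. by split=> // a b; apply: eis_eqP => /=; ring. Qed.
HB.instance Definition _ := GRing.isZmodMorphism.Build F eis emb emb_is_additive.
HB.instance Definition _ :=
  GRing.isMonoidMorphism.Build F eis emb emb_is_multiplicative.

Lemma eisE (x : eis) : x = emb (re_eis x) + om * emb (im_eis x).
Proof. by apply: eis_eqP => /=; ring. Qed.

End Eisenstein.

Arguments om {F}.
Arguments emb {F}.

Lemma om_sqr (R : comNzRingType) (x : R) :
  1 + x + x ^+ 2 = 0 -> x ^+ 2 = - 1 - x.
Proof. by move=> x0; rewrite -[LHS](addKr (1 + x)) x0 addr0 opprD. Qed.

Lemma mpolyC_om_sqr (R : comNzRingType) n (x : R) :
  1 + x + x ^+ 2 = 0 -> x%:MP_[n] ^+ 2 = - 1 - x%:MP.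
Proof.
by move=> /om_sqr x2; rewrite -rmorphXn x2 rmorphD !rmorphN rmorph1.
Qed.

Lemma re_eis_is_additive (F : fieldType) : zmod_morphism (@re_eis F).
Proof. by []. Qed.
Lemma im_eis_is_additive (F : fieldType) : zmod_morphism (@im_eis F).
Proof. by []. Qed.
HB.instance Definition _ (F : fieldType) :=
  GRing.isZmodMorphism.Build (eis F) F (@re_eis F) (@re_eis_is_additive F).
HB.instance Definition _ (F : fieldType) :=
  GRing.isZmodMorphism.Build (eis F) F (@im_eis F) (@im_eis_is_additive F).

Section LinearSubstitution.

Lemma mpoly_morph_ext (R : comNzRingType) (S : comNzRingType) n
    (f g : {rmorphism {mpoly R[n]} -> S}) :
    (forall c, f c%:MP = g c%:MP) -> (forall i, f 'X_i = g 'X_i) -> f =1 g.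
Proof.
move=> fgC fgX p; rewrite [p]mpolyE !rmorph_sum; apply: eq_bigr => m _.
rewrite -mul_mpolyC !rmorphM fgC mpolyXE_id !rmorph_prod; congr (_ * _).
by apply: eq_bigr => i _; rewrite !rmorphXn fgX.
Qed.

Variable R : comNzRingType.

(** The algebra morphism induced by a linear map given on row vectors. For
    the matrix of a group element this is the action on the symmetric algebra. *)
Definition lsub m n (M : 'M[R]_(m, n)) : {mpoly R[m]} -> {mpoly R[n]} :=
  comp_mpoly [tuple \sum_(j < n) M i j *: 'X_j | i < m].

HB.instance Definition _ m n (M : 'M[R]_(m, n)) :=
  GRing.LRMorphism.copy (lsub M)
    (comp_mpoly [tuple \sum_(j < n) M i j *: 'X_j | i < m]).

Lemma lsubX m n (M : 'M[R]_(m, n)) i :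
  lsub M 'X_i = \sum_(j < n) M i j *: 'X_j.
Proof. by rewrite /lsub comp_mpolyXU -tnth_nth tnth_mktuple. Qed.

Lemma lsubC m n (M : 'M[R]_(m, n)) c : lsub M c%:MP = c%:MP.
Proof. exact: comp_mpolyC. Qed.

Lemma lsubD m n (M : 'M[R]_(m, n)) p q : lsub M (p + q) = lsub M p + lsub M q.
Proof. exact: linearD. Qed.

Lemma lsubZ m n (M : 'M[R]_(m, n)) a p : lsub M (a *: p) = a *: lsub M p.
Proof. exact: linearZ. Qed.

Lemma lsub_comp m n k (M : 'M[R]_(n, k)) (N : 'M[R]_(m, n)) p :
  lsub M (lsub N p) = lsub (N *m M) p.
Proof.
move: p; apply: (mpoly_morph_ext (f := lsub M \o lsub N)) => [c|i] /=.
  by rewrite !lsubC.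
rewrite !lsubX linear_sum /=.
under eq_bigr => j _ do rewrite linearZ /= lsubX scaler_sumr.
rewrite exchange_big /=; apply: eq_bigr => j _; rewrite mxE scaler_suml.
by apply: eq_bigr => l _; rewrite scalerA.
Qed.

Lemma lsub1 n (p : {mpoly R[n]}) : lsub 1%:M p = p.
Proof.
move: p; apply: (mpoly_morph_ext (g := idfun)) => [c|i] /=.
  by rewrite lsubC.
rewrite lsubX (bigD1 i) //= mxE eqxx scale1r big1 ?addr0 // => j ji.
by rewrite mxE eq_sym (negPf ji) scale0r.
Qed.

Lemma lsub_homog m n (M : 'M[R]_(m, n)) d p :
  p \is d.-homog -> lsub M p \is d.-homog.
Proof.
move=> hp; rewrite [p]mpolyE linear_sum big_seq rpred_sum // => k kp.
rewrite -(dhomog_mf hp kp).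
rewrite linearZ rpredZ //= mpolyXE_id rmorph_prod mdegE.
elim/big_rec2: _ => [|i d' q _ hq]; first exact: dhomog1.
rewrite dhomogM // rmorphXn /= lsubX; rewrite -[X in _ \is X.-homog]mul1n dhomogMn //.
by apply: rpred_sum => j _; rewrite rpredZ // dhomogX; apply/eqP/mdeg1.
Qed.

End LinearSubstitution.

Lemma lsub_map (R S : comNzRingType) (f : {rmorphism R -> S}) m n
    (M : 'M[R]_(m, n)) p :
  map_mpoly f (lsub M p) = lsub (map_mx f M) (map_mpoly f p).
Proof.
move: p; apply: (mpoly_morph_ext (f := map_mpoly f \o lsub M)
  (g := lsub (map_mx f M) \o map_mpoly f)) => [c|i] /=.
  by rewrite lsubC !map_mpolyC lsubC.
rewrite map_mpolyX !lsubX rmorph_sum /=; apply: eq_bigr => j _.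
by rewrite map_mpolyZ map_mpolyX mxE.
Qed.

Section Scalars.

Variables (F : fieldType) (E : comNzRingType) (emb : {rmorphism F -> E}).
Variables (om : E) (re im : {additive E -> F}) (n : nat).
Hypotheses (om_sum : 1 + om + om ^+ 2 = 0)
  (coordE : forall x, x = emb (re x) + om * emb (im x))
  (re_coord : forall a b, re (emb a + om * emb b) = a)
  (im_coord : forall a b, im (emb a + om * emb b) = b).
Implicit Types (u : {mpoly E[n]}) (p q : {mpoly F[n]}).

(** Polynomials over an extension E of F with basis 1, om, by their
    coordinates. *)
Definition combine p0 p1 : {mpoly E[n]} :=
  map_mpoly emb p0 + om *: map_mpoly emb p1.

Lemma combineE u : u = combine (map_mpoly re u) (map_mpoly im u).
Proof.
by apply/mpolyP => m; rewrite mcoeffD mcoeffZ !mcoeff_map_mpoly -coordE.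
Qed.

Lemma re_combine p0 p1 : map_mpoly re (combine p0 p1) = p0.
Proof.
apply/mpolyP => m; rewrite mcoeff_map_mpoly mcoeffD mcoeffZ !mcoeff_map_mpoly.
exact: re_coord.
Qed.

Lemma im_combine p0 p1 : map_mpoly im (combine p0 p1) = p1.
Proof.
apply/mpolyP => m; rewrite mcoeff_map_mpoly mcoeffD mcoeffZ !mcoeff_map_mpoly.
exact: im_coord.
Qed.

Lemma combine_inj p0 p1 q0 q1 :
  combine p0 p1 = combine q0 q1 -> p0 = q0 /\ p1 = q1.
Proof.
move=> eqc; split; first by rewrite -(re_combine p0 p1) eqc re_combine.
by rewrite -(im_combine p0 p1) eqc im_combine.
Qed.

Lemma lsub_combine (M : 'M[F]_n) p0 p1 :
  lsub (map_mx emb M) (combine p0 p1) = combine (lsub M p0) (lsub M p1).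
Proof. by rewrite /combine linearD linearZ /= -!lsub_map. Qed.

Lemma combineD p0 p1 q0 q1 :
  combine p0 p1 + combine q0 q1 = combine (p0 + q0) (p1 + q1).
Proof. by rewrite /combine !rmorphD scalerDr addrACA. Qed.

Lemma combineM p0 p1 q0 q1 :
  combine p0 p1 * combine q0 q1 =
  combine (p0 * q0 - p1 * q1) (p0 * q1 + p1 * q0 - p1 * q1).
Proof.
rewrite /combine !(rmorphB, rmorphD, rmorphM) /= -!mul_mpolyC.
have om2 := mpolyC_om_sqr n om_sum.
ring: om2.
Qed.

Lemma homog_map (R S : comNzRingType) (f : {additive R -> S}) d (r : {mpoly R[n]}) :
  r \is d.-homog -> map_mpoly f r \is d.-homog.
Proof.
move=> hr; apply/dhomogP => m; rewrite mcoeff_msupp mcoeff_map_mpoly => fm.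
apply: (dhomog_mf hr); rewrite mcoeff_msupp; apply: contraNneq fm => ->.
by rewrite raddf0.
Qed.

End Scalars.

(** * Weight spaces *)

(** The relations between the generators c, z, b, t. They are used in the group,
    for the matrices that represent it, and for matrices that are to define a
    representation. *)
Record group_rels (U : Type) (mul : U -> U -> U) (one c z b t : U) : Prop :=
  GroupRels {
    rel_c3 : mul (mul c c) c = one;
    rel_z2 : mul z z = one;
    rel_b2 : mul b b = one;
    rel_t2 : mul t t = one;
    rel_cz : mul c z = mul z c;
    rel_cb : mul c b = mul b c;
    rel_zb : mul z b = mul b z;
    rel_tc : mul t c = mul (mul c c) t;
    rel_tz : mul t z = mul z t;
    rel_tb : mul t b = mul (mul z b) t }.

Definition fixed_by (R : comNzRingType) n (c z b t : 'M[R]_n) p : Prop :=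
  [/\ lsub c p = p, lsub z p = p, lsub b p = p & lsub t p = p].

Definition gen_le (R : comNzRingType) n (c z b t : 'M[R]_n) (d : nat) :
    {mpoly R[n]} -> Prop :=
  alg_gen (fun q => fixed_by c z b t q /\ exists2 e, (e <= d)%N & q \is e.-homog).

Section WeightSpaces.

Variables (E : comNzRingType) (om half third : E).
Hypotheses (om_sum : 1 + om + om ^+ 2 = 0)
  (half2 : half + half = 1) (third3 : third + third + third = 1).
Variables (n : nat) (c z b t : 'M[E]_n).
Hypothesis rels : group_rels mulmx 1%:M c z b t.

Local Notation S := {mpoly E[n]}.
Implicit Types (p q u : S) (w : weight).

Definition chi3 (a : option bool) : E :=
  match a with None => 1 | Some true => om | Some false => om ^+ 2 end.

Lemma om3 : om ^+ 3 = 1.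
Proof.
have -> : om ^+ 3 = (om - 1) * (1 + om + om ^+ 2) + 1 by ring.
by rewrite om_sum mulr0 add0r.
Qed.

Lemma chi3D a a' : chi3 (add3 a a') = chi3 a * chi3 a'.
Proof.
have o4 : om ^+ 4 = om by rewrite (exprD om 3 1) om3 mul1r.
by case: a a' => [[]|] [[]|] /=; rewrite ?mul1r ?mulr1 // -?exprSr -?exprS -?exprD ?om3.
Qed.

Lemma chi3_sqr a : chi3 a ^+ 2 = chi3 (omap negb a).
Proof. by rewrite expr2 -chi3D; case: a => [[]|]. Qed.

Lemma chi3_opp a : chi3 a * chi3 (omap negb a) = 1.
Proof. by rewrite -chi3D; case: a => [[]|]. Qed.

Lemma chi3_sum a :
  a != None -> 1 + chi3 a + chi3 (omap negb a) = 0.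
Proof. by case: a => [[]|] //= _; rewrite ?om_sum // addrAC. Qed.

Definition has_weight w u : Prop :=
  [/\ lsub c u = chi3 w.1.1 *: u, lsub z u = (-1) ^+ w.1.2 *: u
    & lsub b u = (-1) ^+ w.2 *: u].

Lemma has_weight1 : has_weight w0 1.
Proof. by split; rewrite rmorph1 scale1r. Qed.

Lemma has_weightM w w' u u' :
  has_weight w u -> has_weight w' u' -> has_weight (addw w w') (u * u').
Proof.
case: w w' => [[a s] e] [[a' s'] e'] [/= cu zu bu] [/= cu' zu' bu'].
split; rewrite rmorphM /= ?(cu, zu, bu) ?(cu', zu', bu') -scalerAl -scalerAr scalerA.
- by rewrite chi3D.
- by rewrite signr_addb.
- by rewrite signr_addb.
Qed.

Lemma lsub_tt u : lsub t (lsub t u) = u.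
Proof. by rewrite lsub_comp (rel_t2 rels) lsub1. Qed.

Lemma has_weight_flip w u : has_weight w u -> has_weight (flipw w) (lsub t u).
Proof.
case: w => [[a s] e] [/= cu zu bu]; split=> /=.
- rewrite lsub_comp (rel_tc rels) -!lsub_comp cu !lsubZ cu lsubZ scalerA.
  by rewrite -expr2 chi3_sqr.
- by rewrite lsub_comp (rel_tz rels) -lsub_comp zu lsubZ.
- rewrite lsub_comp (rel_tb rels) -!lsub_comp zu !lsubZ bu lsubZ scalerA.
  by rewrite signr_addb mulrC.
Qed.

(** The projection on the eigenspace of c where c acts as [chi3 a], by averaging. *)
Definition proj_c a u : S :=
  third *: (u + chi3 (omap negb a) *: lsub c u + chi3 a *: lsub c (lsub c u)).
Definition proj2 (g : 'M[E]_n) (s : bool) u : S :=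
  half *: (u + (-1) ^+ s *: lsub g u).
Definition proj w u : S := proj_c w.1.1 (proj2 z w.1.2 (proj2 b w.2 u)).

Lemma proj_c_is_linear a : linear (proj_c a).
Proof.
move=> k u v; rewrite /proj_c !linearP /=.
move: (lsub c u) (lsub c v) (lsub c (lsub c u)) (lsub c (lsub c v)) => *.
by rewrite -!mul_mpolyC; ring.
Qed.
HB.instance Definition _ a :=
  GRing.isLinear.Build E S S _ (proj_c a) (proj_c_is_linear a).

Lemma proj2_is_linear g s : linear (proj2 g s).
Proof.
move=> k u v; rewrite /proj2 !linearP /=.
by move: (lsub g u) (lsub g v) => *; rewrite -!mul_mpolyC; ring.
Qed.
HB.instance Definition _ g s :=
  GRing.isLinear.Build E S S _ (proj2 g s) (proj2_is_linear g s).

Lemma proj_cZ a k u : proj_c a (k *: u) = k *: proj_c a u.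
Proof. exact: linearZ. Qed.

Lemma proj2Z g s k u : proj2 g s (k *: u) = k *: proj2 g s u.
Proof. exact: linearZ. Qed.

Lemma proj_is_linear w : linear (proj w).
Proof. by move=> k u v; rewrite /proj !linearP. Qed.
HB.instance Definition _ w :=
  GRing.isLinear.Build E S S _ (proj w) (proj_is_linear w).

Lemma proj_cE a u : lsub c (proj_c a u) = chi3 a *: proj_c a u.
Proof.
have ccc v : lsub c (lsub c (lsub c v)) = v.
  by rewrite !lsub_comp ?mulmxA (rel_c3 rels) lsub1.
rewrite /proj_c lsubZ !lsubD !lsubZ ccc scalerA mulrC -[RHS]scalerA.
congr (_ *: _); rewrite !scalerDr !scalerA chi3_opp scale1r -expr2 chi3_sqr.
by rewrite addrC addrA.
Qed.

Lemma proj2E g s u : g *m g = 1%:M -> lsub g (proj2 g s u) = (-1) ^+ s *: proj2 g s u.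
Proof.
move=> gg; have ggu v : lsub g (lsub g v) = v by rewrite lsub_comp gg lsub1.
rewrite /proj2 lsubZ lsubD lsubZ ggu scalerA mulrC -[RHS]scalerA; congr (_ *: _).
by rewrite scalerDr scalerA -signr_addb addbb scale1r addrC.
Qed.

Lemma proj_cC g a u : c *m g = g *m c -> lsub g (proj_c a u) = proj_c a (lsub g u).
Proof.
move=> cg; rewrite /proj_c lsubZ !lsubD !lsubZ !lsub_comp.
by rewrite -!mulmxA cg mulmxA cg mulmxA.
Qed.

Lemma proj2C g g' s u : g *m g' = g' *m g -> lsub g' (proj2 g s u) = proj2 g s (lsub g' u).
Proof. by move=> gg; rewrite /proj2 lsubZ lsubD lsubZ !lsub_comp gg. Qed.

Lemma has_weight_proj w u : has_weight w (proj w u).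
Proof.
rewrite /proj; split.
- exact: proj_cE.
- by rewrite proj_cC ?(rel_cz rels) // proj2E ?(rel_z2 rels) // proj_cZ.
- rewrite proj_cC ?(rel_cb rels) // proj2C ?(rel_zb rels) //.
  by rewrite proj2E ?(rel_b2 rels) // proj2Z proj_cZ.
Qed.

Lemma proj2_sum g u : proj2 g false u + proj2 g true u = u.
Proof.
rewrite /proj2 -scalerDr expr0 expr1 scaleN1r scale1r addrACA subrr addr0.
by rewrite scalerDr -scalerDl half2 scale1r.
Qed.

Lemma proj_c_sum u :
  proj_c None u + proj_c (Some true) u + proj_c (Some false) u = u.
Proof.
rewrite /proj_c /= !scale1r.
move: (lsub c u) (lsub c (lsub c u)) => v v'.
transitivity ((third + third + third) *: u
    + (third * (1 + om + om ^+ 2)) *: (v + v')).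
  by rewrite -!mul_mpolyC !(rmorphD, rmorphM, rmorphXn, rmorph1) /=; ring.
by rewrite third3 om_sum mulr0 scale0r scale1r addr0.
Qed.

(** [u] is the sum of its twelve weight components. *)
Lemma sum_proj (P : S -> Prop) u :
  (forall v v', P v -> P v' -> P (v + v')) -> (forall w, P (proj w u)) -> P u.
Proof.
move=> PD Pproj; rewrite -(proj2_sum b u).
have Pb e : P (proj2 b e u).
  rewrite -(proj2_sum z (proj2 b e u)).
  have Pz s : P (proj2 z s (proj2 b e u)).
    rewrite -(proj_c_sum (proj2 z s _)); apply: (PD); first apply: PD.
    - exact: (Pproj (None, s, e)).
    - exact: (Pproj (Some true, s, e)).
    - exact: (Pproj (Some false, s, e)).
  exact: PD.
exact: PD.
Qed.

Lemma proj2_eigen g (s : bool) u : lsub g u = (-1) ^+ s *: u ->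
  proj2 g false u = if s then 0 else u.
Proof.
move=> gu; rewrite /proj2 gu scale1r; case: s gu => _.
  by rewrite expr1 scaleN1r subrr scaler0.
by rewrite scale1r scalerDr -scalerDl half2 scale1r.
Qed.

Lemma proj_c_eigen a u : lsub c u = chi3 a *: u ->
  proj_c None u = if a == None then u else 0.
Proof.
move=> cu; rewrite /proj_c /= !scale1r cu lsubZ cu scalerA -expr2 chi3_sqr.
rewrite -{1}[u]scale1r -!scalerDl scalerA.
case: eqP => [->|/eqP a0] /=.
  by rewrite !mulrDr !mulr1 third3 scale1r.
by rewrite chi3_sum // mulr0 scale0r.
Qed.

Lemma proj_weight w u : has_weight w u -> proj w0 u = if w == w0 then u else 0.
Proof.
case: w => [[a s] e] [/= cu zu bu]; rewrite /proj /= (proj2_eigen bu).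
case: e bu => _; first by rewrite !linear0; case: a s {cu zu} => [[]|] [].
rewrite (proj2_eigen zu); case: s zu => _; first by rewrite linear0; case: a {cu} => [[]|].
by rewrite (proj_c_eigen cu); case: a {cu} => [[]|].
Qed.

Lemma proj_fixed u : lsub c u = u -> lsub z u = u -> lsub b u = u ->
  proj w0 u = u.
Proof. by move=> cu zu bu; rewrite (@proj_weight w0) //; split; rewrite scale1r. Qed.

Lemma proj_homog w d u : u \is d.-homog -> proj w u \is d.-homog.
Proof.
have h2 g s v : v \is d.-homog -> proj2 g s v \is d.-homog.
  by move=> hv; rewrite /proj2 rpredZ // rpredD // rpredZ // lsub_homog.
move=> hu; rewrite /proj; have {}hu := h2 z w.1.2 _ (h2 b w.2 _ hu).
by rewrite /proj_c rpredZ // !rpredD // rpredZ // !lsub_homog.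
Qed.

Variable Alg : S -> Prop.
Hypotheses (AlgD : forall u v, Alg u -> Alg v -> Alg (u + v))
  (AlgM : forall u v, Alg u -> Alg v -> Alg (u * v))
  (AlgC : forall a, Alg a%:MP)
  (Alg_gen : forall u d, (d <= 9)%N -> u \is d.-homog -> lsub c u = u ->
     lsub z u = u -> lsub b u = u -> lsub t u = u -> Alg u).

Lemma AlgZ (a : E) u : Alg u -> Alg (a *: u).
Proof. by move=> Au; rewrite -mul_mpolyC; apply: AlgM. Qed.

(** Up to a scalar, the sum over the group. *)
Definition symmetrize u : S := proj w0 u + lsub t (proj w0 u).

Lemma symmetrize_is_linear : linear symmetrize.
Proof.
move=> k u v.
by rewrite /symmetrize proj_is_linear lsubD lsubZ scalerDr addrACA.
Qed.
HB.instance Definition _ :=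
  GRing.isLinear.Build E S S _ symmetrize symmetrize_is_linear.

Lemma symmetrizeD u v : symmetrize (u + v) = symmetrize u + symmetrize v.
Proof. exact: linearD. Qed.

Lemma symmetrizeZ k u : symmetrize (k *: u) = k *: symmetrize u.
Proof. exact: linearZ. Qed.

Definition linear_weight w u : Prop := has_weight w u /\ u \is 1.-homog.

Lemma monom_has_weight (l : seq (weight * S)) : good linear_weight l ->
  has_weight (sumw (map fst l)) (monom l) /\ monom l \is (size l).-homog.
Proof.
elim: l => [_|[w u] l IHl gl].
  by rewrite /monom big_nil; split; [apply: has_weight1 | apply: dhomog1].
have [|wl hl] := IHl; first by move=> p pl; apply: gl; rewrite inE pl orbT.
have [wu hu] : linear_weight w u by apply: (gl (w, u)); rewrite mem_head.
rewrite /monom big_cons -/(monom l); split; first exact: has_weightM.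
exact: (dhomogM hu hl).
Qed.

Lemma symmetrize_monom l : good linear_weight l -> Alg (symmetrize (monom l)).
Proof.
move=> gl; have [wl hl] := monom_has_weight gl.
rewrite /symmetrize (proj_weight wl); case: eqP => [l0|_]; last first.
  by rewrite linear0 addr0 -mpolyC0.
apply: transfer gl l0 => //.
- exact: rmorphM.
- exact: lsub_tt.
- exact: rmorph1.
- by move=> w u [wu hu]; split; [apply: has_weight_flip | apply: lsub_homog].
- by move=> u Au; rewrite -scaleN1r; apply: AlgZ.
- move=> u /(AlgZ half); rewrite scalerDr -scalerDl half2 scale1r; exact.
move=> m gm m0 sm; have [wm hm] := monom_has_weight gm.
have [cm zm bm] : has_weight w0 (monom m) by rewrite -m0.
have [ctm ztm btm] : has_weight w0 (lsub t (monom m)) 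
  by have := has_weight_flip wm; rewrite m0.
rewrite /= !scale1r in cm zm bm ctm ztm btm.
apply: (Alg_gen sm); rewrite ?linearD /= ?lsub_tt ?cm ?zm ?bm ?ctm ?ztm ?btm //.
  by rewrite rpredD // lsub_homog.
by rewrite addrC.
Qed.

(** The components of the variables are weight vectors, so products of linear
    weight vectors span; those of nonzero total weight are killed by averaging, and
    [transfer] deals with the others. *)
Lemma symmetrize_Alg u : Alg (symmetrize u).
Proof.
suff Q l : good linear_weight l -> Alg (symmetrize (monom l * u)).
  by have := Q [::]; rewrite /monom big_nil mul1r; apply.
have QX i v : (forall l, good linear_weight l -> Alg (symmetrize (monom l * v))) ->
    forall l, good linear_weight l -> Alg (symmetrize (monom l * ('X_i * v))).
  move=> Qv m gm; apply: (sum_proj (u := 'X_i)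
    (P := fun x => Alg (symmetrize (monom m * (x * v))))) => [x y Ax Ay | w].
    by rewrite mulrDl mulrDr symmetrizeD; apply: AlgD.
  rewrite mulrCA; rewrite mulrA.
  have -> : proj w 'X_i * monom m = monom ((w, proj w 'X_i) :: m).
    by rewrite /monom big_cons.
  apply: Qv => p; rewrite inE => /predU1P[-> /= | /gm //]; split.
    exact: has_weight_proj.
  by apply: proj_homog; rewrite dhomogX; apply/eqP/mdeg1.
elim/mpolyind: u l => [|a k p _ _ IHp] l gl.
  by rewrite mulr0 linear0 -mpolyC0.
rewrite mulrDr symmetrizeD; apply: AlgD; last exact: IHp.
rewrite -scalerAr symmetrizeZ; apply: AlgZ.
move: l gl; rewrite mpolyXE_id; elim/big_rec: _ => [|i v _ Qv].
  by move=> l gl; rewrite mulr1; apply: symmetrize_monom.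
elim: (k i) => [|d IHd]; first by rewrite mul1r.
by rewrite exprS -mulrA; apply: QX.
Qed.

Lemma generated_by_Alg u : lsub c u = u -> lsub z u = u -> lsub b u = u ->
  lsub t u = u -> Alg u.
Proof.
move=> cu zu bu tu; have := AlgZ half (symmetrize_Alg u).
by rewrite /symmetrize proj_fixed // tu scalerDr -scalerDl half2 scale1r.
Qed.

End WeightSpaces.

(** * Invariants over the base field *)

Section Inverses.

Variables (F : fieldType) (E : comNzRingType) (emb : {rmorphism F -> E}).

Lemma emb_half : 2%:R != 0 :> F -> emb 2%:R^-1 + emb 2%:R^-1 = 1.
Proof.
by move=> two; rewrite -rmorphD -mulr2n -(mulr_natr 2%:R^-1) mulVf // rmorph1.
Qed.

Lemma emb_third : 3%:R != 0 :> F ->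
  emb 3%:R^-1 + emb 3%:R^-1 + emb 3%:R^-1 = 1.
Proof.
move=> three.
by rewrite -!rmorphD -mulr2n -mulrSr -(mulr_natr 3%:R^-1) mulVf // rmorph1.
Qed.

End Inverses.

Section Descent.

Variables (F : fieldType) (n : nat) (c z b t : 'M[F]_n).
Hypotheses (two : 2%:R != 0 :> F) (three : 3%:R != 0 :> F).
Hypothesis rels : group_rels mulmx 1%:M c z b t.

Local Notation gen9 := (gen_le c z b t 9).

Lemma gen9_opp p : gen9 p -> gen9 (- p).
Proof.
move=> gp; rewrite -mulN1r -(mpolyC1 n F) -rmorphN.
by apply: alg_gen_mul gp; apply: alg_gen_const.
Qed.

Lemma group_rels_map (R S : comNzRingType) (f : {rmorphism R -> S}) k
    (c' z' b' t' : 'M[R]_k) :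
  group_rels mulmx 1%:M c' z' b' t' ->
  group_rels mulmx 1%:M (map_mx f c') (map_mx f z') (map_mx f b') (map_mx f t').
Proof.
case=> c3 z2 b2 t2 cz cb zb tc tz tb.
by split; rewrite -!map_mxM ?(c3, z2, b2, t2, cz, cb, zb, tc, tz, tb) ?map_mx1.
Qed.

(** The elements with both coordinates in the subalgebra generated over F form
    an algebra over E. It contains every invariant over E of degree at most 9, as
    the action has coefficients in F and so respects coordinates; hence it contains
    [p]. *)
Lemma descent (E : comNzRingType) (emb : {rmorphism F -> E}) (om : E)
    (re im : {additive E -> F}) p :
    1 + om + om ^+ 2 = 0 -> (forall x, x = emb (re x) + om * emb (im x)) ->
    (forall x y, re (emb x + om * emb y) = x) ->
    (forall x y, im (emb x + om * emb y) = y) ->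
  fixed_by c z b t p -> gen9 p.
Proof.
move=> om0 coord re_c im_c [cp zp bp tp].
pose comb := combine emb om (n := n).
pose Alg u := exists p0 p1, [/\ gen9 p0, gen9 p1 & u = comb p0 p1].
have comb_inj p0 p1 q0 q1 : comb p0 p1 = comb q0 q1 -> p0 = q0 /\ p1 = q1.
  exact: (combine_inj re_c im_c).
have emb_p : map_mpoly emb p = comb p 0.
  by rewrite /comb /combine rmorph0 scaler0 addr0.
have fix_emb M : lsub M p = p ->
    lsub (map_mx emb M) (map_mpoly emb p) = map_mpoly emb p.
  by rewrite -lsub_map => ->.
have AlgD u v : Alg u -> Alg v -> Alg (u + v).
  move=> [p0 [p1 [g0 g1 ->]]] [q0 [q1 [h0 h1 ->]]].
  by exists (p0 + q0), (p1 + q1); rewrite /comb combineD; split=> //; apply: alg_gen_add.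
have AlgM u v : Alg u -> Alg v -> Alg (u * v).
  move=> [p0 [p1 [g0 g1 ->]]] [q0 [q1 [h0 h1 ->]]].
  exists (p0 * q0 - p1 * q1), (p0 * q1 + p1 * q0 - p1 * q1).
  rewrite /comb (combineM emb om0); split=> //.
    by apply: alg_gen_add; [|apply: gen9_opp]; apply: alg_gen_mul.
  apply: alg_gen_add; first by apply: alg_gen_add; apply: alg_gen_mul.
  by apply: gen9_opp; apply: alg_gen_mul.
have AlgC a : Alg a%:MP.
  exists (re a)%:MP, (im a)%:MP; split; try exact: alg_gen_const.
  by rewrite /comb /combine !map_mpolyC -mul_mpolyC -mpolyCM -mpolyCD -coord.
have Alg_gen u d : (d <= 9)%N -> u \is d.-homog ->
    lsub (map_mx emb c) u = u -> lsub (map_mx emb z) u = u ->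
    lsub (map_mx emb b) u = u -> lsub (map_mx emb t) u = u -> Alg u.
  move=> d9 hu cu zu bu tu.
  have fixE M : lsub (map_mx emb M) u = u ->
    lsub M (map_mpoly re u) = map_mpoly re u /\
    lsub M (map_mpoly im u) = map_mpoly im u.
    move=> Mu; apply: comb_inj; rewrite /comb -lsub_combine.
    by rewrite -(combineE coord u).
  have [cr ci] := fixE _ cu; have [zr zi] := fixE _ zu.
  have [br bi] := fixE _ bu; have [tr ti] := fixE _ tu.
  exists (map_mpoly re u), (map_mpoly im u); split; last exact: (combineE coord u).
    apply: alg_gen_in; split; first exact: (And4 cr zr br tr).
    by exists d; [exact: d9 | exact: homog_map hu].
  apply: alg_gen_in; split; first exact: (And4 ci zi bi ti).
  by exists d; [exact: d9 | exact: homog_map hu].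
have [q0 [q1 [g0 _ e]]] := generated_by_Alg om0 (emb_half emb two)
   (emb_third emb three) (group_rels_map emb rels)
   AlgD AlgM AlgC Alg_gen (fix_emb _ cp) (fix_emb _ zp) (fix_emb _ bp) (fix_emb _ tp).
by move: e; rewrite emb_p => /comb_inj[-> _].
Qed.

Lemma generated_by_gen9 p : fixed_by c z b t p -> gen9 p.
Proof.
apply: (@descent (eis F) emb om (@re_eis F) (@im_eis F)).
- exact: om_sum.
- exact: eisE.
- by move=> x y /=; ring.
- by move=> x y /=; ring.
Qed.

End Descent.

(** * Generators of the group *)

Section GroupStructure.

Local Open Scope group_scope.

Lemma setX_Zp2_expg (v : 'Z_2 * 'Z_2) : v ^+ 2 = 1.
Proof. by case: v => [[[|[|i]] hi] [[|[|j]] hj]] //; apply/eqP. Qed.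

(** If x is an element of order 4 of the dihedral group H and b an element
    of the centralizer of K in H that is not in <x>, then z = x^2 and t = x b are suitable.
    As this centralizer has order 4 and exponent 2 it cannot avoid <x>, nor contain x;
    hence it contains z but not t, which therefore inverts K. *)
Lemma group_generators (gT : finGroupType) (G K H : {group gT}) :
    K ><| H = G -> K \isog Zp 3 -> H \isog 'D_8 ->
    'C_H(K) \isog setX (Zp 2) (Zp 2) ->
  exists c z b t, [/\ group_rels mulg 1 c z b t, #|G| = 24,
    [/\ c \in G, z \in G, b \in G & t \in G] & G \subset <<[set c; z; b; t]>>].
Proof.
case/sdprodP=> _ defG nKH tiKH isoK isoH isoV.
have oK : #|K| = 3 by rewrite (card_isog isoK) card_Zp.
have [[x y] [oH Hx ox H'y] [oy xy]] := generators_2dihedral (n := 3) isT isoH.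
have {}ox : #[x] = 4 := ox; have {}oH : #|H| = 8 := oH.
set V := 'C_H(K) in isoV.
have oV : #|V| = 4 by rewrite (card_isog isoV) cardsX !card_Zp.
have expV v : v \in V -> v ^+ 2 = 1.
  have /isogP[f injf _] := isoV => Vv; apply: (injmP injf); rewrite ?groupX //.
  by rewrite morphX // morph1 setX_Zp2_expg.
have V'x : x \notin V.
  by apply: contra_eqN ox => /expV /eqP; rewrite -order_dvdn; apply: contraTN => /eqP->.
have [b Vb X'b] : exists2 b, b \in V & b \notin <[x]>.
  apply/subsetPn; apply: contraNN V'x => sVX; have/eqP-> : V == <[x]>.
    by rewrite eqEcard sVX -orderE ox oV.
  exact: cycle_id.
have [Hb Cb] := setIP Vb.
have Vz : x ^+ 2 \in V.
  have: <[x]> :&: V != 1.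
    apply/eqP => ti; have sXVH : <[x]> * V \subset H.
      by rewrite mul_subG ?cycle_subG // subsetIl.
    by have := subset_leq_card sXVH; rewrite TI_cardMg // -orderE ox oV oH.
  case/trivgPn=> v /setIP[/cyclePmin[i lti ->] Vv] ntv.
  rewrite ox in lti; case: i lti Vv ntv => [|[|[|[|//]]]] _ Vv.
  - by rewrite eqxx.
  - by rewrite -(expg1 x) Vv in V'x.
  - by [].
  - have x4 : x ^+ 4 = 1 by apply/eqP; rewrite -order_dvdn ox.
    suff xV : x^-1 \in V by rewrite -groupV xV in V'x.
    have -> : x^-1 = x ^+ 3 by apply/eqP; rewrite eq_invg_mul -expgS x4.
    by [].
have X'Hb : b \in H :\: <[x]> by rewrite inE X'b.
have gens : extremal_generators H 2 3 (x, b) by split.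
have [[/sdprodP[_ defH _ _] inv2 conjX] _ _ _ _] := dihedral2_structure (n := 3) isT gens isoH.
pose t := x * b; have X't : t \in H :\: <[x]>.
  by rewrite inE /t groupMl ?cycle_id // X'b groupM.
have V't : t \notin V by rewrite /t groupMr.
have ob : b ^+ 2 = 1 by rewrite expV.
have ot : t ^+ 2 = 1 by apply/eqP; rewrite -order_dvdn (inv2 t X't).
have ox4 : x ^+ 4 = 1 by apply/eqP; rewrite -order_dvdn ox.
have [c Kc oc] : {c | c \in K & #[c] = 3}.
  by apply: Cauchy; rewrite ?oK.
have defK : <[c]> = K by apply/eqP; rewrite eqEcard cycle_subG Kc -orderE oc oK.
have oc3 : c ^+ 3 = 1 by apply/eqP; rewrite -order_dvdn oc.
have [Ht _] := setDP X't.
have zz : (x ^+ 2)^-1 = x ^+ 2 by apply/eqP; rewrite eq_invg_mul -expgD ox4.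
have commz h : h \in H :\: <[x]> -> h * x ^+ 2 = x ^+ 2 * h.
  move=> Xh; have := conjX _ _ (mem_cycle x 2) Xh.
  by rewrite zz => /conjg_fixP/commgP.
have commK v : v \in V -> c * v = v * c.
  by case/setIP=> _ /centP/(_ c Kc).
have ct : c ^ t = c^-1.
  have Kct : c ^ t \in <[c]> by rewrite defK memJ_norm // (subsetP nKH).
  case/cyclePmin: Kct => i; rewrite oc; case: i => [|[|[|//]]] _ E.
  - by move/eqP: E; rewrite expg0 conjg_eq1 => /eqP c1; rewrite c1 invg1 conj1g.
  - case/negP: V't; rewrite inE Ht -defK cent_cycle; apply/cent1P/commute_sym/commgP.
    by apply/conjg_fixP; rewrite E.
  - by rewrite E; apply/esym/eqP; rewrite eq_invg_mul -expgS oc3.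
have c3 : c * c * c = 1 by rewrite -[RHS]oc3 !expgS expg0 mulg1 mulgA.
have tV : t^-1 = t by apply/eqP; rewrite eq_invg_mul -[t * t]/(t ^+ 2) ot.
have tc : t * c = c * c * t.
  have cc : c * c = c^-1 by apply: (mulIg c); rewrite mulVg.
  by rewrite conjgCV tV ct cc.
have bV : b^-1 = b by apply/eqP; rewrite eq_invg_mul -[b * b]/(b ^+ 2) ob.
have tb : t * b = x ^+ 2 * b * t.
  have xb : x ^ b = x^-1 by apply: conjX; rewrite ?cycle_id.
  rewrite /t -mulgA -[b * b]/(b ^+ 2) ob mulg1 -mulgA.
  have -> : b * (x * b) = x^-1 by rewrite -xb conjgE bV.
  by rewrite expgS expg1 mulgK.
exists c, (x ^+ 2), b, t; split.
- split=> //; rewrite ?commK ?(commz b) ?(commz t) //.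
  by rewrite -expgnDr.
- by rewrite -defG TI_cardMg // oK oH.
- have sHG : H \subset G by rewrite -defG mulG_subr.
  have sKG : K \subset G by rewrite -defG mulG_subl.
  by rewrite (subsetP sKG _ Kc) !(subsetP sHG) // groupX.
have gen g : g \in [set c; x ^+ 2; b; t] -> g \in <<[set c; x ^+ 2; b; t]>>.
  exact: mem_gen.
have gen_c : c \in <<[set c; x ^+ 2; b; t]>> by apply: gen; rewrite !inE eqxx.
have gen_b : b \in <<[set c; x ^+ 2; b; t]>> by apply: gen; rewrite !inE eqxx ?orbT.
have gen_t : t \in <<[set c; x ^+ 2; b; t]>> by apply: gen; rewrite !inE eqxx ?orbT.
rewrite -defG mul_subG // -?defK -?defH ?mul_subG ?cycle_subG ?gen_c ?gen_b //.
by have := groupM gen_t (groupVr gen_b); rewrite {1}/t mulgK.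
Qed.

End GroupStructure.

(** * Normal forms and representations *)

Section NormalForm.

Variables (U : Type) (mul : U -> U -> U) (one c z b t : U).
Hypotheses (mulA : associative mul) (mul1 : left_id one mul)
  (mulr1 : right_id one mul).
Hypothesis rels : group_rels mul one c z b t.

Local Notation "x ** y" := (mul x y) (at level 40, left associativity).

Definition pow3 x (i : option bool) :=
  match i with None => one | Some true => x | Some false => x ** x end.
Definition pow2 x (s : bool) := if s then x else one.

Definition word (p : weight * bool) : U :=
  let: (i, s, e, l) := p in pow3 c i ** (pow2 z s ** (pow2 b e ** pow2 t l)).

(** Conjugation by t on the element c^i z^s b^e of A. It is dual to [flipw]. *)
Definition conjw (v : weight) : weight :=
  let: (i, s, e) := v in (omap negb i, s (+) e, e).
Definition mulp (p q : weight * bool) : weight * bool :=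
  (addw p.1 (if p.2 then conjw q.1 else q.1), p.2 (+) q.2).

Lemma pow3D i j : pow3 c i ** pow3 c j = pow3 c (add3 i j).
Proof.
have c3 := rel_c3 rels; have c3' : c ** (c ** c) = one by rewrite mulA.
by case: i j => [[]|] [[]|] /=; rewrite ?mul1 ?mulr1 ?c3 ?c3' // -mulA c3' mulr1.
Qed.

Lemma pow2D x s e : x ** x = one -> pow2 x s ** pow2 x e = pow2 x (s (+) e).
Proof. by move=> xx; case: s e => [] []; rewrite /= ?mul1 ?mulr1 ?xx. Qed.

Lemma pow2_comm x y s e : x ** y = y ** x -> pow2 x s ** pow2 y e = pow2 y e ** pow2 x s.
Proof. by move=> xy; case: s e => [] []; rewrite /= ?mul1 ?mulr1 ?xy. Qed.

Lemma pow23_comm y s i : c ** y = y ** c ->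
  pow2 y s ** pow3 c i = pow3 c i ** pow2 y s.
Proof.
move=> cy; case: s i => [] [[]|]; rewrite /= ?mul1 ?mulr1 //.
by rewrite -mulA cy mulA -cy -mulA cy.
Qed.

Lemma t_pow3 i : t ** pow3 c i = pow3 c (omap negb i) ** t.
Proof.
have c3' x : c ** (c ** (c ** x)) = x by rewrite !mulA (rel_c3 rels) mul1.
case: i => [[]|] /=; rewrite ?mul1 ?mulr1 ?(rel_tc rels) //.
by rewrite mulA (rel_tc rels) -mulA (rel_tc rels) -!mulA c3'.
Qed.

Lemma t_pow2b e : t ** pow2 b e = pow2 z e ** (pow2 b e ** t).
Proof. by case: e; rewrite /= ?mul1 ?mulr1 // (rel_tb rels) mulA. Qed.

(** The product of normal forms is computed by the same rule wherever the
    relations hold. *)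
Lemma word_mul p q : word p ** word q = word (mulp p q).
Proof.
case: p q => [[[i s] e] l] [[[i' s'] e'] l'].
have tz s1 : t ** pow2 z s1 = pow2 z s1 ** t.
  by case: s1; rewrite /= ?mul1 ?mulr1 // (rel_tz rels).
have move_t : pow2 t l ** (pow3 c i' ** (pow2 z s' ** pow2 b e')) =
    (let: (i1, s1, e1) := if l then conjw (i', s', e') else (i', s', e') in
     pow3 c i1 ** (pow2 z s1 ** (pow2 b e1 ** pow2 t l))).
  case: (l) => /=; last by rewrite mul1 mulr1.
  rewrite mulA t_pow3 -mulA; congr (_ ** _); rewrite mulA tz -mulA t_pow2b.
  by rewrite mulA (pow2D _ _ (rel_z2 rels)).
have -> : word (i, s, e, l) ** word (i', s', e', l') =
    pow3 c i ** (pow2 z s ** (pow2 b e **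
      (pow2 t l ** (pow3 c i' ** (pow2 z s' ** pow2 b e')) ** pow2 t l'))).
  by rewrite /word !mulA.
rewrite move_t /mulp /=; case: (if l then _ else _) => [[i1 s1] e1].
rewrite /word /addw /= -pow3D -!(pow2D _ _ (rel_z2 rels)) -!(pow2D _ _ (rel_b2 rels)).
rewrite -(pow2D _ _ (rel_t2 rels)) !mulA; congr (_ ** _ ** _).
rewrite -!mulA; congr (_ ** _).
rewrite [pow2 b e ** _]mulA (pow23_comm _ _ (rel_cb rels)) -mulA.
rewrite [pow2 z s ** _]mulA (pow23_comm _ _ (rel_cz rels)) -mulA.
congr (_ ** (_ ** _)); rewrite mulA (pow2_comm _ _ (esym (rel_zb rels))) -!mulA.
by [].
Qed.

End NormalForm.

Section Representation.

Variables (F : fieldType) (gT : finGroupType) (G : {group gT}) (c z b t : gT).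
Hypotheses (rels : group_rels mulg 1%g c z b t) (oG : #|G| = 24).
Hypotheses (Gc : c \in G) (Gz : z \in G) (Gb : b \in G) (Gt : t \in G).
Hypothesis genG : G \subset <<[set c; z; b; t]>>%g.

Local Notation wordG := (word mulg 1%g c z b t).

Lemma wordG_mul p q : (wordG p * wordG q)%g = wordG (mulp p q).
Proof. exact: (word_mul (@mulgA gT) (@mul1g gT) (@mulg1 gT) rels). Qed.

Lemma wordG_onto : G \subset [set wordG p | p : weight * bool].
Proof.
have gI : group_set [set wordG p | p : weight * bool].
  apply/group_setP; split.
    by apply/imsetP; exists (w0, false) => //; rewrite /= !mul1g.
  by move=> _ _ /imsetP[p _ ->] /imsetP[q _ ->]; rewrite wordG_mul imset_f.
rewrite (subset_trans genG) // (gen_subG _ (Group gI)) /=.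
apply/subsetP => g; rewrite !inE => /orP[/orP[/orP[]|]|] /eqP->; apply/imsetP.
- by exists (Some true, false, false, false) => //; rewrite /= !mulg1.
- by exists (None, true, false, false) => //; rewrite /= !mulg1 mul1g.
- by exists (None, false, true, false) => //; rewrite /= mulg1 !mul1g.
- by exists (None, false, false, true) => //; rewrite /= !mul1g.
Qed.

(** The 24 normal forms exhaust a group of order 24. *)
Lemma wordG_inj : injective wordG.
Proof.
have : #|[set wordG p | p : weight * bool]| == #|{: weight * bool}|.
  rewrite eqn_leq leq_imset_card /= !card_prod card_option !card_bool.
  by rewrite -[X in (X <= _)%N]oG; apply: subset_leq_card wordG_onto.
by move/imset_injP => inj p q; apply: inj.
Qed.

Variables (n : nat) (mc mz mb mt : 'M[F]_n).
Hypothesis mrels : group_rels mulmx 1%:M mc mz mb mt.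

Local Notation wordM := (word mulmx 1%:M mc mz mb mt).

Definition word_of (g : gT) : weight * bool :=
  odflt (w0, false) [pick p | wordG p == g].

Lemma word_ofK p : word_of (wordG p) = p.
Proof.
rewrite /word_of; case: pickP => [q /eqP/wordG_inj -> // | /(_ p)].
by rewrite eqxx.
Qed.

Lemma wordM_mul p q : wordM p *m wordM q = wordM (mulp p q).
Proof. exact: (word_mul (@mulmxA F n n n n) (@mul1mx F n n) (@mulmx1 F n n) mrels). Qed.

Lemma word_repr : mx_repr G (fun g => wordM (word_of g)).
Proof.
split.
  have -> : 1%g = wordG (w0, false) by rewrite /= !mul1g.
  by rewrite word_ofK /= !mul1mx.
move=> g h /(subsetP wordG_onto)/imsetP[p _ ->] /(subsetP wordG_onto)/imsetP[q _ ->].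
by rewrite wordG_mul !word_ofK wordM_mul.
Qed.

(** Sending the normal form of an element to the same word in the matrices is
    multiplicative, by [word_mul] on both sides. *)
Lemma representation_of_matrices :
  exists rG : mx_representation F G n,
    [/\ rG c = mc, rG z = mz, rG b = mb & rG t = mt].
Proof.
exists (MxRepresentation word_repr) => /=; split.
- have -> : c = wordG (Some true, false, false, false) by rewrite /= !mulg1.
  by rewrite word_ofK /= !mulmx1.
- have -> : z = wordG (None, true, false, false) by rewrite /= !mulg1 mul1g.
  by rewrite word_ofK /= !mulmx1 mul1mx.
- have -> : b = wordG (None, false, true, false) by rewrite /= mulg1 !mul1g.
  by rewrite word_ofK /= mulmx1 !mul1mx.
- have -> : t = wordG (None, false, false, true) by rewrite /= !mul1g.
  by rewrite word_ofK /= !mul1mx.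
Qed.

End Representation.

Lemma alg_gen_mono (R : comNzRingType) n (A B : {mpoly R[n]} -> Prop) p :
  (forall q, A q -> B q) -> alg_gen A p -> alg_gen B p.
Proof.
move=> AB; elim=> {p} [p /AB | k | p q _ ? _ ? | p q _ ? _ ?].
- exact: alg_gen_in.
- exact: alg_gen_const.
- exact: alg_gen_add.
- exact: alg_gen_mul.
Qed.

Section Invariants.

Variables (F : fieldType) (gT : finGroupType) (G : {group gT}) (c z b t : gT).
Hypotheses (Gc : c \in G) (Gz : z \in G) (Gb : b \in G) (Gt : t \in G).
Hypothesis genG : G \subset <<[set c; z; b; t]>>%g.
Variables (n : nat) (rG : mx_representation F G n).

Lemma invariant_fixed p :
  Defs.invariant rG p <-> fixed_by (rG c) (rG z) (rG b) (rG t) p.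
Proof.
split=> [inv | [cp zp bp tp] g Gg]; first by split; apply: inv.
pose stab := [set g in G | sym_act rG g p == p].
have gstab : group_set stab.
  apply/group_setP; split.
    by rewrite inE group1 /sym_act repr_mx1; apply/eqP/lsub1.
  move=> g1 g2; rewrite !inE => /andP[G1 /eqP p1] /andP[G2 /eqP p2].
  have actE h : sym_act rG h p = lsub (rG h) p by [].
  rewrite !actE in p1 p2 *.
  by rewrite groupM // repr_mxM // -lsub_comp p1 p2 eqxx.
have : G \subset stab.
  rewrite (subset_trans genG) // (gen_subG _ (Group gstab)) /=.
  apply/subsetP => h; rewrite !inE => /orP[/orP[/orP[]|]|] /eqP->.
  - by rewrite Gc /=; apply/eqP.
  - by rewrite Gz /=; apply/eqP.
  - by rewrite Gb /=; apply/eqP.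
  - by rewrite Gt /=; apply/eqP.
by move/subsetP/(_ g Gg); rewrite inE => /andP[_ /eqP].
Qed.

Lemma rG_rels : group_rels mulg 1%g c z b t ->
  group_rels mulmx 1%:M (rG c) (rG z) (rG b) (rG t).
Proof.
case=> c3 z2 b2 t2 cz cb zb tc tz tb; split.
- by rewrite -!repr_mxM ?groupM // c3 repr_mx1.
- by rewrite -!repr_mxM ?groupM // z2 repr_mx1.
- by rewrite -!repr_mxM ?groupM // b2 repr_mx1.
- by rewrite -!repr_mxM ?groupM // t2 repr_mx1.
- by rewrite -!repr_mxM ?groupM // cz.
- by rewrite -!repr_mxM ?groupM // cb.
- by rewrite -!repr_mxM ?groupM // zb.
- by rewrite -!repr_mxM ?groupM // tc.
- by rewrite -!repr_mxM ?groupM // tz.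
- by rewrite -!repr_mxM ?groupM // tb.
Qed.

Lemma invariants_gen_leE d : invariants_gen_le rG d <->
  forall p, fixed_by (rG c) (rG z) (rG b) (rG t) p ->
    gen_le (rG c) (rG z) (rG b) (rG t) d p.
Proof.
split=> gen p /invariant_fixed/gen; apply: alg_gen_mono => q [fq hq];
  by split=> //; apply/invariant_fixed.
Qed.

End Invariants.


(** * The module for the lower bound *)

Section Blocks.

Variable R : comNzRingType.

(** Linear maps respecting the decomposition of a space into a line, spanned
    by w, and two copies of one space, with bases the u_i and the v_i. *)
Definition block3 k l (a : R) (A B C D : 'M[R]_(k, l)) : 'M[R]_(1 + (k + k), 1 + (l + l)) :=
  block_mx a%:M 0 0 (block_mx A B C D).

Lemma block3_mul k l m a a' (A B C D : 'M[R]_(k, l)) (A' B' C' D' : 'M[R]_(l, m)) :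
  block3 a A B C D *m block3 a' A' B' C' D' =
  block3 (a * a') (A *m A' + B *m C') (A *m B' + B *m D')
    (C *m A' + D *m C') (C *m B' + D *m D').
Proof.
by rewrite /block3 !mulmx_block !mul0mx !mulmx0 !addr0 !add0r -scalar_mxM.
Qed.

Lemma block3_1 k : block3 1 1%:M 0 0 1%:M = 1%:M :> 'M[R]_(1 + (k + k)).
Proof. by rewrite /block3 -!scalar_mx_block. Qed.

Definition iw k : 'I_(1 + (k + k)) := lshift (k + k) ord0.
Definition iu k (i : 'I_k) : 'I_(1 + (k + k)) := rshift 1 (lshift k i).
Definition iv k (i : 'I_k) : 'I_(1 + (k + k)) := rshift 1 (rshift k i).

Section Action.

Variables (k l : nat) (a : R) (A B C D : 'M[R]_(k, l)).
Local Notation g := (lsub (block3 a A B C D)).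

Lemma block3_w : g 'X_(iw k) = a *: 'X_(iw l).
Proof.
rewrite lsubX big_split_ord /= big_ord1 [X in _ + X]big1 => [|j _].
  by rewrite block_mxEul mxE eqxx addr0.
by rewrite block_mxEur mxE scale0r.
Qed.

Lemma block3_u i : g 'X_(iu i) =
  \sum_j A i j *: 'X_(iu j) + \sum_j B i j *: 'X_(iv j).
Proof.
rewrite lsubX big_split_ord /= big_ord1 block_mxEdl mxE scale0r add0r.
rewrite big_split_ord /=; congr (_ + _); apply: eq_bigr => j _.
  by rewrite block_mxEdr block_mxEul.
by rewrite block_mxEdr block_mxEur.
Qed.

Lemma block3_v i : g 'X_(iv i) =
  \sum_j C i j *: 'X_(iu j) + \sum_j D i j *: 'X_(iv j).
Proof.
rewrite lsubX big_split_ord /= big_ord1 block_mxEdl mxE scale0r add0r.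
rewrite big_split_ord /=; congr (_ + _); apply: eq_bigr => j _.
  by rewrite block_mxEdr block_mxEdl.
by rewrite block_mxEdr block_mxEdr.
Qed.

End Action.

(** The line is a character that is -1 on b and t; on the sum of two copies,
    c acts by [r] and its inverse, b by 1 and -1, z by -1, and t exchanges the copies.
    Over F, [r] is a rotation of order 3 in dimension 2; over F[om] it is the scalar
    om in dimension 1. *)
Section Generators.

Variables (k : nat) (r : 'M[R]_k).

Definition mx_c := block3 1 r 0 0 (r *m r).
Definition mx_z := block3 1 (- 1%:M : 'M[R]_k) 0 0 (- 1%:M).
Definition mx_b := block3 (-1) (1%:M : 'M[R]_k) 0 0 (- 1%:M).
Definition mx_t := block3 (-1) (0 : 'M[R]_k) 1%:M 1%:M 0.

Lemma mx_rels : r *m r *m r = 1%:M -> group_rels mulmx 1%:M mx_c mx_z mx_b mx_t.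
Proof.
move=> r3; have r3' : r *m r *m (r *m r) = r by rewrite mulmxA r3 mul1mx.
rewrite /mx_c /mx_z /mx_b /mx_t; split; rewrite !block3_mul -?block3_1;
  rewrite !(mul0mx, mulmx0, mul1mx, mulmx1, mulNmx, mulmxN, addr0, add0r, opprK,
    mul1r, mulr1, mulN1r, mulrN1, oppr0, r3, r3') //.
by rewrite mulmxA r3.
Qed.

End Generators.
End Blocks.

(** * Invariants of low degree *)

Lemma mcoeff_lsub_diag (R : comNzRingType) n (M : 'M[R]_n) (d : 'I_n -> R) :
    (forall i, lsub M 'X_i = d i *: 'X_i) ->
  forall q m, (lsub M q)@_m = (\prod_i d i ^+ m i) * q@_m.
Proof.
move=> MX q; elim/mpolyind: q => [|a k p _ _ IHp] m.
  by rewrite rmorph0 mcoeff0 mulr0.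
have -> : lsub M (a *: 'X_[k] + p) = a *: ((\prod_i d i ^+ k i) *: 'X_[k]) + lsub M p.
  rewrite lsubD lsubZ mpolyXE_id rmorph_prod -scaler_prod; congr (_ *: _ + _).
  by apply: eq_bigr => i _; rewrite rmorphXn /= MX exprZn.
rewrite !mcoeffD !mcoeffZ IHp mcoeffX mulrDr; congr (_ + _).
by case: eqP => [->|_]; rewrite ?mulr0 // !mulr1 mulrC.
Qed.

Section ThreeVariables.

Variables (E : comNzRingType) (om half third : E).
Hypotheses (om_sum : 1 + om + om ^+ 2 = 0)
  (half2 : half + half = 1) (third3 : third + third + third = 1).

Local Notation S := {mpoly E[1 + (1 + 1)]}.
Local Notation jw := (iw 1).
Local Notation ju := (iu (ord0 : 'I_1)).
Local Notation jv := (iv (ord0 : 'I_1)).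
Local Notation wt_c := (mx_c (om%:M : 'M[E]_1)).
Local Notation wt_z := (mx_z E 1).
Local Notation wt_b := (mx_b E 1).
Local Notation wt_t := (mx_t E 1).
Implicit Types q : S.

Definition neg_w : 'M[E]_(1 + (1 + 1)) := block3 (-1) 1%:M 0 0 1%:M.

Local Notation fixed3 := (fixed_by wt_c wt_z wt_b wt_t).

Lemma index3 (P : 'I_(1 + (1 + 1)) -> Prop) : P jw -> P ju -> P jv -> forall i, P i.
Proof.
move=> Pw Pu Pv i; rewrite -(splitK i); case: (split i) => j /=.
  by rewrite (ord1 j).
by rewrite -(splitK j); case: (split j) => l /=; rewrite (ord1 l).
Qed.

Lemma prod3 (T : comNzRingType) (f : 'I_(1 + (1 + 1)) -> T) :
  \prod_i f i = f jw * (f ju * f jv).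
Proof. by rewrite !big_split_ord /= !big_ord1. Qed.

Lemma sum3 (f : 'I_(1 + (1 + 1)) -> nat) : (\sum_i f i = f jw + (f ju + f jv))%N.
Proof. by rewrite !big_split_ord /= !big_ord1. Qed.

Lemma lsub_diag3 (a x y : E) i :
  lsub (block3 a (x%:M : 'M_1) 0 0 y%:M) 'X_i =
    (if i == jw then a else if i == ju then x else y) *: 'X_i :> S.
Proof.
elim/index3: i.
- by rewrite block3_w eqxx.
- by rewrite block3_u !big_ord1 !mxE eqxx /= scale0r addr0.
- by rewrite block3_v !big_ord1 !mxE eqxx /= scale0r add0r.
Qed.

Lemma mcoeff_diag3 (a x y : E) q m :
  (lsub (block3 a (x%:M : 'M_1) 0 0 y%:M) q)@_m =
    a ^+ m jw * (x ^+ m ju * y ^+ m jv) * q@_m.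
Proof. by rewrite (mcoeff_lsub_diag (lsub_diag3 a x y)) prod3. Qed.

Lemma sign_eq0 (k : nat) (x : E) : (-1) ^+ k * x = x -> odd k -> x = 0.
Proof.
rewrite -signr_odd => + ok; rewrite ok expr1 mulN1r => nx.
by rewrite -[x]mul1r -half2 mulrDl -{2}nx mulrN subrr.
Qed.

Lemma om_eq0 k (x : E) : om ^+ k * x = x -> ~~ (3 %| k)%N -> x = 0.
Proof.
move=> ox k3; have o3 := om3 om_sum.
have okE : om ^+ k = om ^+ (k %% 3).
  by rewrite {1}(divn_eq k 3) exprD mulnC exprM o3 expr1n mul1r.
have [e1 e2] : om * x = x /\ om ^+ 2 * x = x.
  move: ox k3; rewrite okE /dvdn; have: (k %% 3 < 3)%N by rewrite ltn_mod.
  case: (k %% 3)%N => [|[|[|//]]] // _ ox _.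
    by rewrite expr1 in ox; split; rewrite ?expr2 -?mulrA ?ox.
  by split=> //; rewrite -{1}ox mulrA -exprS o3 mul1r.
have x0 : x = third * (x + om * x + om ^+ 2 * x).
  by rewrite e1 e2 !mulrDr -!mulrDl third3 mul1r.
have sum0 : x + om * x + om ^+ 2 * x = 0.
  by rewrite -[X in X + _ + _]mul1r -!mulrDl om_sum mul0r.
by rewrite x0 sum0 mulr0.
Qed.

Lemma wt_cE : wt_c = block3 1 om%:M 0 0 (om ^+ 2)%:M.
Proof. by rewrite /mx_c -scalar_mxM expr2. Qed.
Lemma wt_zE : wt_z = block3 1 (-1)%:M 0 0 (-1)%:M.
Proof. by rewrite /mx_z raddfN. Qed.
Lemma wt_bE : wt_b = block3 (-1) 1%:M 0 0 (-1)%:M.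
Proof. by rewrite /mx_b raddfN. Qed.

Lemma support3 q m : fixed3 q -> q@_m != 0 ->
  [/\ (3 %| m ju + 2 * m jv)%N, ~~ odd (m ju + m jv) & ~~ odd (m jw + m jv)].
Proof.
case=> cq zq bq _ /eqP qm.
have := mcoeff_diag3 1 om (om ^+ 2) q m; rewrite -wt_cE cq.
have := mcoeff_diag3 1 (-1) (-1) q m; rewrite -wt_zE zq.
have := mcoeff_diag3 (-1) 1 (-1) q m; rewrite -wt_bE bq.
rewrite !expr1n !mul1r -!exprM -!exprD => bm zm cm.
split; apply/negP => h; apply: qm.
- exact: (om_eq0 (esym cm)) (introN idP h).
- exact: sign_eq0 (esym zm) h.
- exact: sign_eq0 (esym bm) h.
Qed.

(** Twice the part of [q] of odd degree in w, [r], is fixed by t. Its monomials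
    w^a u^i v^j have a, i and j odd, and i - j is divisible by 6; as i + j < 8 this
    forces i = j, so t negates them. *)
Lemma low_degree_w_even q d : (d <= 8)%N -> fixed3 q -> q \is d.-homog ->
  lsub neg_w q = q.
Proof.
move=> d8 fq hq; pose r := q - lsub neg_w q.
have rE m : r@_m = q@_m - (-1) ^+ m jw * q@_m.
  by rewrite mcoeffB /neg_w mcoeff_diag3 !expr1n !mulr1.
have supp_r m : m \in msupp r -> odd (m jw) /\ m ju = m jv.
  rewrite mcoeff_msupp rE => rm.
  have ow : odd (m jw).
    by apply: contraNT rm => ew; rewrite -signr_odd (negPf ew) mul1r subrr.
  split=> //; have qm : q@_m != 0.
    by apply: contraNneq rm => ->; rewrite mulr0 subrr.
  have [m3 m2 mwv] := support3 fq qm.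
  have : mdeg m = d by apply: (dhomog_mf hq); rewrite mcoeff_msupp.
  rewrite mdegE sum3 => md.
  have := odd_gt0 ow; move: m3 m2 mwv ow md d8; rewrite !oddD; lia.
have t_r : lsub wt_t r = r.
  have tq : lsub wt_t q = q by case: fq.
  rewrite /r rmorphB /= tq; congr (_ - _).
  have -> : lsub wt_t (lsub neg_w q) = lsub neg_w (lsub wt_t q).
    by rewrite !lsub_comp /mx_t /neg_w !block3_mul !(mulmx1, mul1mx, mulmx0, mul0mx, addr0, add0r).
  by rewrite tq.
have t_Nr : lsub wt_t r = - r.
  rewrite [r]mpolyE linear_sum -sumrN big_seq [RHS]big_seq; apply: eq_bigr => m mr.
  have [ow uv] := supp_r m mr.
  rewrite /= lsubZ -scalerN; congr (_ *: _); rewrite mpolyXE_id rmorph_prod !prod3.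
  rewrite !rmorphXn /= block3_w block3_u block3_v !big_ord1 !mxE /= !scale0r !scale1r.
  rewrite add0r addr0 scaleN1r exprNn -signr_odd ow expr1 uv.
  by rewrite mulN1r mulNr [X in _ * X]mulrC.
have r0 : r = 0.
  by rewrite -[r]scale1r -half2 scalerDl -{1}t_r t_Nr scalerN addNr.
by apply/esym/eqP; rewrite -subr_eq0 -/r r0.
Qed.

End ThreeVariables.

(** * An invariant of degree 9 that is not generated in lower degree *)

Section LowerBound.

Variable F : fieldType.

Definition rot3 : 'M[F]_2 :=
  \matrix_(i, j) if i == ord0 then (j != ord0)%:R else - 1.

Lemma rot3_sqr : rot3 *m rot3 =
  \matrix_(i, j) if i == ord0 then - 1 else (j == ord0)%:R.
Proof.
apply/matrixP => i j; rewrite !mxE !big_ord_recl big_ord0 !mxE /=.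
by case: i j => [[|[|i]] hi] [[|[|j]] hj] //; rewrite /= ?mulr0n ?mulr1n; ring.
Qed.

Lemma rot3_cube : rot3 *m rot3 *m rot3 = 1%:M.
Proof.
rewrite rot3_sqr; apply/matrixP => i j; rewrite !mxE !big_ord_recl big_ord0 !mxE /=.
by case: i j => [[|[|i]] hi] [[|[|j]] hj] //; rewrite /= ?mulr0n ?mulr1n; ring.
Qed.

Local Notation W := ('X_(iw 2) : {mpoly F[1 + (2 + 2)]}).
Local Notation x0 := ('X_(iu (ord0 : 'I_2)) : {mpoly F[1 + (2 + 2)]}).
Local Notation x1 := ('X_(iu (lift ord0 ord0 : 'I_2)) : {mpoly F[1 + (2 + 2)]}).
Local Notation y0 := ('X_(iv (ord0 : 'I_2)) : {mpoly F[1 + (2 + 2)]}).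
Local Notation y1 := ('X_(iv (lift ord0 ord0 : 'I_2)) : {mpoly F[1 + (2 + 2)]}).

(** The sum over the powers of c of the images of x0 y0, where c acts on
    (x0, x1) by [rot3] and on (y0, y1) by its inverse. *)
Definition pairing (T : comNzRingType) (a b c d : T) : T :=
  a * c - b * c - (b * d + b * d) - a * d.
(** The product of the three conjugates of x0 under [rot3], up to sign. *)
Definition cubic (T : comNzRingType) (a b : T) : T := a * b * (a + b).

Definition witness : {mpoly F[1 + (2 + 2)]} :=
  W * pairing x0 x1 y0 y1 * (cubic x0 x1 ^+ 2 - cubic y0 y1 ^+ 2).

Lemma rmorph_witness (T : comNzRingType)
    (f : {rmorphism {mpoly F[1 + (2 + 2)]} -> T}) :
  f witness = f W * pairing (f x0) (f x1) (f y0) (f y1) *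
    (cubic (f x0) (f x1) ^+ 2 - cubic (f y0) (f y1) ^+ 2).
Proof.
rewrite /witness /pairing /cubic.
by rewrite !(rmorphM, rmorphB, rmorphD, rmorphXn).
Qed.

Lemma witness_fixed :
  fixed_by (mx_c rot3) (mx_z F 2) (mx_b F 2) (mx_t F 2) witness.
Proof.
split; rewrite rmorph_witness /= !(block3_w, block3_u, block3_v) ?rot3_sqr.
all: rewrite !big_ord_recl !big_ord0 !mxE /=.
all: rewrite ?scale0r ?scale1r ?scaleN1r ?oppr0 ?scale0r ?scale1r ?addr0 ?add0r.
all: rewrite /witness /pairing /cubic.
all: move: W x0 x1 y0 y1 => *; ring.
Qed.

Section Extension.

Variables (E : comNzRingType) (emb : {rmorphism F -> E}) (om half third : E).
Hypotheses (om_sum : 1 + om + om ^+ 2 = 0)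
  (half2 : half + half = 1) (third3 : third + third + third = 1).

Definition eig : 'M[E]_(2, 1) := \matrix_(i, j) if i == ord0 then 1 else om.
(** The projection on the span of w and of the eigenvectors u and v: it sends (x0, x1) to
    (u, om u) and (y0, y1) to (v, om v). *)
Definition diagonalize : 'M[E]_(1 + (2 + 2), 1 + (1 + 1)) := block3 1 eig 0 0 eig.

Lemma rot3_eig : map_mx emb rot3 *m eig = eig *m om%:M.
Proof.
have om2 := om_sqr om_sum.
apply/matrixP => i j; rewrite mul_mx_scalar !mxE !big_ord_recl big_ord0 !mxE /=.
case: i => [[|[|i]] hi] //=; rewrite ?rmorph0 ?rmorph1 ?rmorphN ?rmorph1; first by ring.
by rewrite -expr2 om2; ring.
Qed.

Lemma map_block3 k l (a : F) (A B C D : 'M[F]_(k, l)) :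
  map_mx emb (block3 a A B C D) =
  block3 (emb a) (map_mx emb A) (map_mx emb B) (map_mx emb C) (map_mx emb D).
Proof. by rewrite /block3 !map_block_mx map_scalar_mx !map_mx0. Qed.

Lemma diagonalize_gens :
  [/\ map_mx emb (mx_c rot3) *m diagonalize = diagonalize *m mx_c om%:M,
     map_mx emb (mx_z F 2) *m diagonalize = diagonalize *m mx_z E 1,
     map_mx emb (mx_b F 2) *m diagonalize = diagonalize *m mx_b E 1
   & map_mx emb (mx_t F 2) *m diagonalize = diagonalize *m mx_t E 1].
Proof.
rewrite /mx_c /mx_z /mx_b /mx_t /diagonalize !map_block3.
rewrite !(map_mx0, map_mx1, map_mxN, map_mxM, rmorph1, rmorphN).
rewrite !block3_mul !(mul0mx, mulmx0, mul1mx, mulmx1, mulNmx, mulmxN, addr0, add0r).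
by rewrite !(mul1r, mulr1) rot3_eig -mulmxA rot3_eig !mulmxA rot3_eig.
Qed.

Definition to_weights (p : {mpoly F[1 + (2 + 2)]}) : {mpoly E[1 + (1 + 1)]} :=
  lsub diagonalize (map_mpoly emb p).

Lemma to_weights_fixed p :
  fixed_by (mx_c rot3) (mx_z F 2) (mx_b F 2) (mx_t F 2) p ->
  fixed_by (mx_c om%:M) (mx_z E 1) (mx_b E 1) (mx_t E 1) (to_weights p).
Proof.
case=> cp zp bp tp; have [cd zd bd td] := diagonalize_gens.
split; rewrite /to_weights lsub_comp.
- by rewrite -cd -lsub_comp -lsub_map cp.
- by rewrite -zd -lsub_comp -lsub_map zp.
- by rewrite -bd -lsub_comp -lsub_map bp.
- by rewrite -td -lsub_comp -lsub_map tp.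
Qed.

Lemma generated_w_even d p : (d <= 8)%N ->
  gen_le (mx_c rot3) (mx_z F 2) (mx_b F 2) (mx_t F 2) d p ->
  lsub (neg_w E) (to_weights p) = to_weights p.
Proof.
move=> d8; elim=> {p} [p [fp [e ed hp]] | k | p q _ IHp _ IHq | p q _ IHp _ IHq].
- apply: (low_degree_w_even om_sum half2 third3 (leq_trans ed d8)).
    exact: to_weights_fixed.
  by apply: lsub_homog; apply: homog_map.
- by rewrite /to_weights map_mpolyC !lsubC.
- by rewrite /to_weights !rmorphD /= -/(to_weights p) -/(to_weights q) IHp IHq.
- by rewrite /to_weights !rmorphM /= -/(to_weights p) -/(to_weights q) IHp IHq.
Qed.

Local Notation w := ('X_(iw 1) : {mpoly E[1 + (1 + 1)]}).
Local Notation u := ('X_(iu (ord0 : 'I_1)) : {mpoly E[1 + (1 + 1)]}).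
Local Notation v := ('X_(iv (ord0 : 'I_1)) : {mpoly E[1 + (1 + 1)]}).

(** [pairing] becomes 3 u v and the two [cubic] become - u^3 and - v^3. *)
Lemma to_weights_witness :
  to_weights witness = 3%:R * (w * u * v * (u ^+ 6 - v ^+ 6)).
Proof.
have om2 := mpolyC_om_sqr (1 + (1 + 1)) om_sum.
have -> : to_weights witness = (lsub diagonalize \o map_mpoly emb) witness by [].
rewrite rmorph_witness /= !map_mpolyX !(block3_w, block3_u, block3_v).
rewrite !big_ord1 !mxE /= !scale0r !scale1r !addr0 !add0r /pairing /cubic.
rewrite -!mul_mpolyC; move: w u v => W u v; ring: om2.
Qed.

Lemma to_weights_witness_coeff :
  (to_weights witness)@_(U_(iw 1) + (U_(iu (ord0 : 'I_1)) *+ 7 + U_(iv (ord0 : 'I_1))))%MM = 3%:R.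
Proof.
rewrite to_weights_witness.
have -> : w * u * v * (u ^+ 6 - v ^+ 6) =
    'X_[(U_(iw 1) + (U_(iu (ord0 : 'I_1)) *+ 7 + U_(iv (ord0 : 'I_1))))%MM] -
    'X_[(U_(iw 1) + (U_(iu (ord0 : 'I_1)) + U_(iv (ord0 : 'I_1)) *+ 7))%MM].
  by rewrite !(mpolyXD, =^~ mpolyXn); move: w u v => W u v; ring.
rewrite -(rmorph_nat (@mpolyC _ E)) mcoeffCM mcoeffB !mcoeffX eqxx.
case: eqP => [/mnmP/(_ (iu ord0))|_]; last by rewrite subr0 mulr1.
by rewrite !mnmE !eqxx.
Qed.

Lemma witness_w_odd : lsub (neg_w E) (to_weights witness) = - to_weights witness.
Proof.
rewrite to_weights_witness -(rmorph_nat (@mpolyC _ E)).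
rewrite !rmorphM rmorphB !rmorphXn /= lsubC.
rewrite block3_w block3_u block3_v !big_ord1 !mxE /= !scale0r !scale1r addr0 add0r.
by rewrite scaleN1r !mulNr mulrN.
Qed.

Lemma witness_not_generated d : (d <= 8)%N ->
  ~ gen_le (mx_c rot3) (mx_z F 2) (mx_b F 2) (mx_t F 2) d witness.
Proof.
move=> d8 /(generated_w_even d8); rewrite witness_w_odd => odd_w.
have := to_weights_witness_coeff.
have -> : to_weights witness = 0.
  by rewrite -[LHS]scale1r -half2 scalerDl -{1}odd_w scalerN addNr.
rewrite mcoeff0 => /esym three0; have := third3.
have -> : third + third + third = third * 3%:R by ring.
by rewrite three0 mulr0 => /esym/eqP; rewrite oner_eq0.
Qed.

End Extension.
End LowerBound.

Lemma natr_neq0 (F : fieldType) p : prime p -> p \notin [pchar F] -> p%:R != 0 :> F.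
Proof. by move=> pp; apply: contra => p0; rewrite inE pp. Qed.

Lemma classical_minimum (P : nat -> Prop) n : P n -> exists2 d, is_minimum P d & (d <= n)%N.
Proof.
have [k] := ubnP n; elim: k n => // k IHk n nk Pn.
have [[m Pm mn] | no] := classic (exists2 m, P m & (m < n)%N).
  have [|d md dm] := IHk m _ Pm; first exact: leq_trans mn nk.
  by exists d => //; apply: leq_trans dm (ltnW mn).
exists n => //; split=> // m Pm; rewrite leqNgt; apply/negP => mn.
by apply: no; exists m.
Qed.

Local Close Scope ring_scope.

Theorem proposition3p5 (F : fieldType) (gT : finGroupType) (G K H : {group gT})
    (char2 : 2 \notin [pchar F]%R) (char3 : 3 \notin [pchar F]%R)
    (semidirect : (K ><| H = G)%g)
    (isoK : (K \isog Zp 3)%g)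
    (isoH : (H \isog 'D_8)%g)
    (ker_conj : ('C_H(K) \isog setX (Zp 2) (Zp 2))%g) :
  is_noether_number F G 9.
Proof.
have two := natr_neq0 (p := 2) isT char2; have three := natr_neq0 (p := 3) isT char3.
have [c [z [b [t [rels oG [Gc Gz Gb Gt] genG]]]]] :=
  group_generators semidirect isoK isoH ker_conj.
split=> [n rG | e bound_e].
  apply/classical_minimum/(invariants_gen_leE Gc Gz Gb Gt genG) => p.
  exact: (generated_by_gen9 two three (rG_rels Gc Gz Gb Gt rG rels)).
have [rG [rc rz rb rt]] := representation_of_matrices rels oG genG (mx_rels (rot3_cube F)).
have [d [/(invariants_gen_leE Gc Gz Gb Gt genG) gen_d _] de] := bound_e _ rG.
rewrite ltnNge; apply/negP => e8.
apply: (@witness_not_generated _ _ (@emb F) _ _ _ (om_sum F) (emb_half emb two)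
  (emb_third emb three) d (leq_trans de e8)).
rewrite rc rz rb rt in gen_d; exact/gen_d/witness_fixed.
Qed.
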